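(* Let $(\mathcal L,[\cdot_\lambda\cdot],\alpha)$ be a multiplicative Hom-Lie conformal algebra, and let $m_c\in C^2_\alpha(\mathcal L,\mathcal L)$ be the element $(m_c)_\lambda(x,y)=[x_\lambda y]$. Then the map $$d_{m_c}=[m_c,-]^{\alpha}_{NR}: C^{*}_\alpha(\mathcal L,\mathcal L)\to C^{*+1}_\alpha(\mathcal L,\mathcal L),\qquad d_{m_c}(f)=[m_c,f]^{\alpha}_{NR},$$ is a differential operator, that is, a $\mathbb C$-linear map sending $C^n_\alpha(\mathcal L,\mathcal L)$ to $C^{n+1}_\alpha(\mathcal L,\mathcal L)$ for every $n\ge 1$ and satisfying $d_{m_c}\circ d_{m_c}=0$.
   Context: All vector spaces and tensor products are over $\mathbb C$; $\lambda,\mu,\lambda_i$ are formal variables. A Hom-Lie conformal algebra $(\mathcal L,[\cdot_\lambda\cdot],\alpha)$ is a $\mathbb C[\partial]$-module $\mathcal L$ with a $\mathbb C$-bilinear map $[\cdot_\lambda\cdot]:\mathcal L\otimes\mathcal L\to\mathcal L[\lambda]$ and a $\mathbb C$-linear map $\alpha:\mathcal L\to\mathcal L$ with $\alpha\partial=\partial\alpha$, such that $[\partial x_\lambda y]=-\lambda[x_\lambda y]$, $[x_\lambda\partial y]=(\partial+\lambda)[x_\lambda y]$, $[x_\lambda y]=-[y_{-\lambda-\partial}x]$ and $[\alpha(x)_\lambda[y_\mu z]]=[[x_\lambda y]_{\lambda+\mu}\alpha(z)]+[\alpha(y)_\mu[x_\lambda z]]$. Here, if $[y_\mu x]=\sum_k\mu^kc_k$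 then $[y_{-\lambda-\partial}x]=\sum_k(-\lambda-\partial)^kc_k$. It is multiplicative if $\alpha([x_\lambda y])=[\alpha(x)_\lambda\alpha(y)]$. Cochains. For $n\ge1$, $C^n_\alpha(\mathcal L,\mathcal L)$ is the space of $\mathbb C$-linear maps $f_{\lambda_1,\dots,\lambda_{n-1}}:\mathcal L^{\otimes n}\to\mathcal L[\lambda_1,\dots,\lambda_{n-1}]$ such that (i) $\alpha(f_{\lambda_1,\dots,\lambda_{n-1}}(x_1,\dots,x_n))=f_{\lambda_1,\dots,\lambda_{n-1}}(\alpha(x_1),\dots,\alpha(x_n))$; (ii) replacing $x_i$ by $\partial x_i$ multiplies the value by $-\lambda_i$ if $i\le n-1$ and by $\partial+\lambda_1+\cdots+\lambda_{n-1}$ if $i=n$; (iii) for every permutation $\tau$ of $\{1,\dots,n\}$, $f_{\lambda_1,\dots,\lambda_{n-1}}(x_1,\dots,x_n)=\operatorname{sgn}(\tau)f_{\lambda_{\tau(1)},\dots,\lambda_{\tau(n-1)}}(x_{\tau(1)},\dots,x_{\tau(n)})|_{\lambda_n=-\lambda_1-\cdots-\lambda_{n-1}-\partial}$. Put $C^*_\alpha(\mathcal L,\mathcal L)=\bigoplus_{n\ge1}C^n_\alpha(\mathcal L,\mathcal L)$. Convention: in a formula with $N$ arguments and free variables $\lambda_1,\dots,\lambda_{N-1}$, the symbol $\lambda_N$ stands for $-\lambda_1-\cdots-\lambda_{N-1}-\partial$, with $\partial$ acting from the left on the total value. For $f\in C^m_\alpha(\mathcal L,\mathcal L)$, $g\in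 C^n_\alpha(\mathcal L,\mathcal L)$ define $$(f\circledcirc g)_{\lambda_1,\dots,\lambda_{m+n-2}}(x_1,\dots,x_{m+n-1})=\sum_{\tau\in S_{n,m-1}}\operatorname{sgn}(\tau)\,f_{\lambda_{\tau(1)}+\cdots+\lambda_{\tau(n)},\lambda_{\tau(n+1)},\dots,\lambda_{\tau(m+n-2)}}\big(g_{\lambda_{\tau(1)},\dots,\lambda_{\tau(n-1)}}(x_{\tau(1)},\dots,x_{\tau(n)}),\alpha^{n-1}(x_{\tau(n+1)}),\dots,\alpha^{n-1}(x_{\tau(m+n-1)})\big),$$ where $S_{n,m-1}$ is the set of permutations with $\tau(1)<\cdots<\tau(n)$ and $\tau(n+1)<\cdots<\tau(n+m-1)$ (when $m=1$ the outer $f$ carries no parameter). The Nijenhuis–Richardson bracket is $[f,g]^\alpha_{NR}=f\circledcirc g-(-1)^{(m-1)(n-1)}g\circledcirc f\in C^{m+n-1}_\alpha(\mathcal L,\mathcal L)$; it makes $C^*_\alpha(\mathcal L,\mathcal L)$ a graded Lie algebra with $C^n_\alpha$ in degree $n-1$. *)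

(* Defs.v *)
From HB Require Import structures.
From mathcomp Require Import all_boot all_order all_fingroup all_algebra.
From mathcomp Require Import monalg mpoly.

Set Implicit Arguments.
Unset Strict Implicit.
Unset Printing Implicit Defensive.

Import GRing.Theory.
Local Open Scope ring_scope.

(* A C[d]-module is an [lmodType {poly F}] with F the field of complex numbers:
   d acts as ['X *: _] and a scalar [c : F] as [c%:P *: _].
   Accordingly [mpoly k {poly F}] (written out because the notation of mpoly.v
   is overridden by monalg.v) is C[d][l_1, ..., l_k], in which d is
   ['X%:MP], a scalar c is [c%:P%:MP] and l_(i+1) is ['X_i]. *)

(* L[l_1, ..., l_k]: finitely supported families of elements of L indexed by
   the monomials in l_1, ..., l_k. *)
Definition vpoly (F : fieldType) (L : lmodType {poly F}) (k : nat) : Type :=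
  {malg L['X_{1..k}]}.

Definition vcoef (F : fieldType) (L : lmodType {poly F}) (k : nat)
  (m : 'X_{1..k}) (w : vpoly L k) : L := monalg.mcoeff m w.

Definition vsupp (F : fieldType) (L : lmodType {poly F}) (k : nat)
  (w : vpoly L k) : seq 'X_{1..k} := finmap.enum_fset (monalg.msupp w).

(* The monomial v * l^m. *)
Definition vmon (F : fieldType) (L : lmodType {poly F}) (k : nat)
  (m : 'X_{1..k}) (v : L) : vpoly L k := mkmalgU m v.

HB.instance Definition _ (F : fieldType) (L : lmodType {poly F}) (k : nat) :=
  GRing.Zmodule.copy (vpoly L k) {malg L['X_{1..k}]}.

(* L[l_1, ..., l_k] as a module over C[d][l_1, ..., l_k]. *)
Section VpolyModule.
Variables (F : fieldType) (L : lmodType {poly F}) (k : nat).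
Implicit Types (A B : mpoly k {poly F}) (v w : vpoly L k) (m a b : 'X_{1..k}).

Definition vscale A w : vpoly L k :=
  \sum_(a <- msupp A) \sum_(b <- vsupp w) vmon (a + b)%MM (A@_a *: vcoef b w).

Fact vmonD m : {morph (@vmon F L k m) : x y / x + y}.
Proof. exact: monalgUD. Qed.

Fact vmon0 m : vmon m 0 = 0 :> vpoly L k.
Proof. exact: monalgU0. Qed.

Fact vcoefD m : {morph (@vcoef F L k m) : x y / x + y}.
Proof. exact: monalg.mcoeffD. Qed.

Fact vcoef_mon m (x : L) m' : vcoef m' (vmon m x) = if m == m' then x else 0.
Proof. by rewrite /vcoef /vmon monalg.mcoeffU mulrb. Qed.

Fact vpolyE w : w = \sum_(m <- vsupp w) vmon m (vcoef m w).
Proof. exact: monalgE. Qed.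

Fact vcoef_out m w : m \notin vsupp w -> vcoef m w = 0.
Proof. by move=> mw; apply: monalg.mcoeff_outdom. Qed.

Fact vsupp_uniq w : uniq (vsupp w).
Proof. exact: finmap.fset_uniq. Qed.

Fact vsum_widen (V : zmodType) (h : 'X_{1..k} -> L -> V) w (s : seq 'X_{1..k}) :
  (forall m, h m 0 = 0) -> uniq s -> {subset vsupp w <= s} ->
  \sum_(m <- vsupp w) h m (vcoef m w) = \sum_(m <- s) h m (vcoef m w).
Proof.
move=> h0 us sub; rewrite [RHS](bigID (mem (vsupp w))) /=.
rewrite [X in _ = _ + X]big1 ?addr0; last by move=> m /vcoef_out ->.
rewrite -[RHS]big_filter; apply/perm_big/uniq_perm.
- exact: vsupp_uniq.
- exact: filter_uniq.
- by move=> m; rewrite mem_filter; case: (boolP (m \in vsupp w)) => // /sub ->.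
Qed.

Fact vsumD (V : zmodType) (h : 'X_{1..k} -> L -> V) v w :
  (forall m, {morph h m : x y / x + y}) ->
  \sum_(m <- vsupp (v + w)) h m (vcoef m (v + w)) =
  \sum_(m <- vsupp v) h m (vcoef m v) + \sum_(m <- vsupp w) h m (vcoef m w).
Proof.
move=> hD; have h0 m : h m 0 = 0.
  by apply: (addrI (h m 0)); rewrite -hD !addr0.
pose s := undup (vsupp v ++ vsupp w ++ vsupp (v + w)).
have us : uniq s by apply: undup_uniq.
have sub u : u \in [:: v; w; v + w] ->
    \sum_(m <- vsupp u) h m (vcoef m u) = \sum_(m <- s) h m (vcoef m u).
  move=> uvw; apply: vsum_widen => // m mu; rewrite mem_undup !mem_cat.
  by move: uvw; rewrite !inE => /or3P[]/eqP <-; rewrite mu ?orbT.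
rewrite (sub v) ?(sub w) ?(sub (v + w)) ?inE ?eqxx ?orbT // -big_split.
by apply: eq_bigr => m _; rewrite vcoefD hD.
Qed.

Fact vsum_mon (V : zmodType) (h : 'X_{1..k} -> L -> V) m (x : L) :
  (forall m', h m' 0 = 0) ->
  \sum_(m' <- vsupp (vmon m x)) h m' (vcoef m' (vmon m x)) = h m x.
Proof.
move=> h0; rewrite (@vsum_widen V h _ [:: m]) //.
  by rewrite big_seq1 vcoef_mon eqxx.
by move=> m' /(finmap.fsubsetP (@msuppU_le _ _ m x)); rewrite finmap.in_fset1 inE.
Qed.

Fact msum_widen (V : zmodType) (h : 'X_{1..k} -> {poly F} -> V) A
    (s : seq 'X_{1..k}) :
  (forall m, h m 0 = 0) -> uniq s -> {subset msupp A <= s} ->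
  \sum_(m <- msupp A) h m A@_m = \sum_(m <- s) h m A@_m.
Proof.
move=> h0 us sub; rewrite [RHS](bigID (mem (msupp A))) /=.
rewrite [X in _ = _ + X]big1 ?addr0; last by move=> m /memN_msupp_eq0 ->.
rewrite -[RHS]big_filter; apply/perm_big/uniq_perm.
- exact: msupp_uniq.
- exact: filter_uniq.
- by move=> m; rewrite mem_filter; case: (boolP (m \in msupp A)) => // /sub ->.
Qed.

Fact vscaleDr A : {morph vscale A : v w / v + w}.
Proof.
move=> v w; rewrite /vscale -big_split; apply: eq_bigr => a _ /=.
apply: (vsumD (h := fun b x => vmon (a + b)%MM (A@_a *: x))) => b x y.
by rewrite scalerDr vmonD.
Qed.

Fact vscaleDl w : {morph vscale^~ w : A B / A + B}.
Proof.
move=> A B; rewrite /vscale.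
pose h a (p : {poly F}) := \sum_(b <- vsupp w) vmon (a + b)%MM (p *: vcoef b w).
have hD a : {morph h a : p q / p + q}.
  move=> p q; rewrite /h -big_split; apply: eq_bigr => b _.
  by rewrite scalerDl vmonD.
have h0 a : h a 0 = 0 by apply: (addrI (h a 0)); rewrite -hD !addr0.
pose s := undup (msupp A ++ msupp B ++ msupp (A + B)).
have us : uniq s by apply: undup_uniq.
have sub C : C \in [:: A; B; A + B] ->
    \sum_(m <- msupp C) h m C@_m = \sum_(m <- s) h m C@_m.
  move=> CABC; apply: msum_widen => // m mC; rewrite mem_undup !mem_cat.
  by move: CABC; rewrite !inE => /or3P[]/eqP <-; rewrite mC ?orbT.
rewrite -/(h _ _) (sub (A + B)) ?(sub A) ?(sub B) ?inE ?eqxx ?orbT //.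
by rewrite -big_split; apply: eq_bigr => m _; rewrite mcoeffD hD.
Qed.

Fact vscale_mon (p : {poly F}) a b (x : L) :
  vscale (p *: 'X_[a]) (vmon b x) = vmon (a + b)%MM (p *: x).
Proof.
rewrite /vscale.
pose h a' (q : {poly F}) :=
  \sum_(b' <- vsupp (vmon b x)) vmon (a' + b')%MM (q *: vcoef b' (vmon b x)).
have hE a' q : h a' q = vmon (a' + b)%MM (q *: x).
  rewrite /h (vsum_mon (h := fun b' y => vmon (a' + b')%MM (q *: y))) // => m.
  by rewrite scaler0 vmon0.
have h0 a' : h a' 0 = 0 by rewrite hE scale0r vmon0.
have sub : {subset msupp (p *: 'X_[a]) <= [:: a]}.
  by move=> m /msuppZ_le; rewrite msuppX.
by rewrite (msum_widen (h := h) h0 _ sub) // big_seq1 mcoeffZ mcoeffX eqxx mulr1 hE.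
Qed.

Fact vpoly_ind (P : vpoly L k -> Prop) :
  P 0 -> (forall m x, P (vmon m x)) -> (forall v w, P v -> P w -> P (v + w)) ->
  forall w, P w.
Proof. by move=> P0 P1 PD w; rewrite [w]vpolyE; apply: big_ind. Qed.

Fact mpoly_ind_monomials (P : mpoly k {poly F} -> Prop) :
  P 0 -> (forall p m, P (p *: 'X_[m])) -> (forall A B, P A -> P B -> P (A + B)) ->
  forall A, P A.
Proof. by move=> P0 P1 PD A; rewrite [A]mpolyE; apply: big_ind. Qed.

Fact vscaler0 A : vscale A 0 = 0.
Proof. by apply: (addrI (vscale A 0)); rewrite -vscaleDr !addr0. Qed.

Fact vscale0r w : vscale 0 w = 0.
Proof. by rewrite /vscale msupp0 big_nil. Qed.

Fact vscaleA A B w : vscale A (vscale B w) = vscale (A * B) w.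
Proof.
elim/vpoly_ind: w => [|m x|v w IHv IHw]; first by rewrite !vscaler0.
  elim/mpoly_ind_monomials: B => [|q b|B C IHB IHC].
  - by rewrite mulr0 !vscale0r vscaler0.
  - elim/mpoly_ind_monomials: A => [|p a|A D IHA ID].
    + by rewrite mul0r !vscale0r.
    + have -> : (p *: 'X_[a]) * (q *: 'X_[b]) = (p * q) *: 'X_[(a + b)%MM].
        by rewrite -scalerAl -[X in _ *: X = _]scalerAr scalerA mpolyXD.
      by rewrite (vscale_mon q) (vscale_mon p) (vscale_mon (p * q)) scalerA addmA.
    + by rewrite mulrDl (vscaleDl _ A D) (vscaleDl _ (A * _)) IHA ID.
  - rewrite mulrDr (vscaleDl _ B C) (vscaleDl _ (A * B)) (vscaleDr A (vscale B _)).
    exact: (f_equal2 +%R IHB IHC).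
rewrite (vscaleDr B) (vscaleDr A) (vscaleDr (A * B)).
exact: (f_equal2 +%R IHv IHw).
Qed.

Fact vscale1r : left_id 1 vscale.
Proof.
elim/vpoly_ind=> [|m x|v w IHv IHw]; first exact: vscaler0.
  by rewrite -mpolyX0 -['X_[0%MM]]scale1r vscale_mon add0m scale1r.
by rewrite vscaleDr IHv IHw.
Qed.

End VpolyModule.

HB.instance Definition _ (F : fieldType) (L : lmodType {poly F}) (k : nat) :=
  GRing.Zmodule_isLmodule.Build (mpoly k {poly F}) (vpoly L k)
    (@vscaleA F L k) (@vscale1r F L k) (@vscaleDr F L k) (@vscaleDl F L k).

Section Conformal.
Variables (F : fieldType) (L : lmodType {poly F}).

(* The polynomial sum_m h(P_m) * prod_i E_i^(m_i): the coefficients of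
   P in L[l_1, ..., l_k] are fed to h and the variables l_i replaced by E_i. *)
Definition vextend (k r : nat) (E : 'I_k -> mpoly r {poly F})
  (h : L -> vpoly L r) (P : vpoly L k) : vpoly L r :=
  \sum_(m <- vsupp P) (\prod_i E i ^+ m i) *: h (vcoef m P).

Definition vsubst (k r : nat) (E : 'I_k -> mpoly r {poly F})
  (P : vpoly L k) : vpoly L r := vextend E (vmon 0%MM) P.

Definition vmap (k : nat) (h : L -> L) (P : vpoly L k) : vpoly L k :=
  \sum_(m <- vsupp P) vmon m (h (vcoef m P)).

(* l_1, ..., l_r for j < r, and -l_1 - ... - l_r - d for j = r, the latter
   being the meaning of l_(r+1) in a formula with r+1 arguments. *)
Definition lam (r : nat) (j : 'I_r.+1) : mpoly r {poly F} :=
  if unlift ord_max j is Some i then 'X_i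
  else - (\sum_(i < r) 'X_i) - 'X%:MP.

Section HomLie.
Variables (br : L -> L -> vpoly L 1) (alpha : L -> L).

(* [x_A y], that is [x_l y] at l = A. *)
Definition br_at (r : nat) (A : mpoly r {poly F}) (x y : L) : vpoly L r :=
  vsubst (fun=> A) (br x y).

Record is_hom_lie_conformal : Prop := {
  hlc_linl : forall c x x' y,
    br (c%:P *: x + x') y = c%:P%:MP *: br x y + br x' y;
  hlc_linr : forall c x y y',
    br x (c%:P *: y + y') = c%:P%:MP *: br x y + br x y';
  hlc_alpha_lin : forall c x x',
    alpha (c%:P *: x + x') = c%:P *: alpha x + alpha x';
  hlc_alpha_partial : forall x, alpha ('X *: x) = 'X *: alpha x;
  hlc_partiall : forall x y, br ('X *: x) y = - 'X_ord0 *: br x y;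
  hlc_partialr : forall x y, br x ('X *: y) = ('X%:MP + 'X_ord0) *: br x y;
  hlc_skew : forall x y, br x y = - br_at (- 'X_ord0 - 'X%:MP) y x;
  (* In two variables, l is ['X_ord0] and mu is ['X_ord_max]. *)
  hlc_jacobi : forall x y z,
    let l : mpoly 2 {poly F} := 'X_ord0 in
    let mu : mpoly 2 {poly F} := 'X_ord_max in
    vextend (fun=> mu) (fun u => br_at l (alpha x) u) (br y z) =
    vextend (fun=> l) (fun u => br_at (l + mu) u (alpha z)) (br x y) +
    vextend (fun=> l) (fun u => br_at mu (alpha y) u) (br x z)
}.

Definition multiplicative_hlc : Prop :=
  forall x y, vmap alpha (br x y) = br (alpha x) (alpha y).

End HomLie.

(* An element of [precochain k] has k+1 arguments and k variables; those lying
   in C^(k+1)_alpha(L, L), which is the component of degree k, are singled out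
   by [is_cochain]. Arguments and variables are numbered from 0. *)
Definition precochain (k : nat) : Type := {ffun 'I_k.+1 -> L} -> vpoly L k.

Definition upd (k : nat) (x : {ffun 'I_k.+1 -> L}) (i : 'I_k.+1) (u : L) :
  {ffun 'I_k.+1 -> L} := [ffun j => if j == i then u else x j].

Section Cochains.
Variable alpha : L -> L.

Record is_cochain (k : nat) (f : precochain k) : Prop := {
  cochain_lin : forall (x : {ffun 'I_k.+1 -> L}) i c u v,
    f (upd x i (c%:P *: u + v)) =
    c%:P%:MP *: f (upd x i u) + f (upd x i v);
  cochain_alpha : forall x, vmap alpha (f x) = f [ffun i => alpha (x i)];
  cochain_partial : forall x (i : 'I_k),
    f (upd x (lift ord_max i) ('X *: x (lift ord_max i))) = - 'X_i *: f x;
  cochain_partial_last : forall x,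
    f (upd x ord_max ('X *: x ord_max)) = ('X%:MP + \sum_(i < k) 'X_i) *: f x;
  cochain_skew : forall (tau : 'S_k.+1) (x : {ffun 'I_k.+1 -> L}),
    f x = (-1) ^+ odd_perm tau *:
      vsubst (fun i : 'I_k => lam (tau (lift ord_max i)))
             (f [ffun i => x (tau i)])
}.

(* S_{q+1,p} with r = p+q. *)
Definition shuffle (r q : nat) (tau : 'S_r.+1) : bool :=
  [forall i : 'I_r.+1, forall j : 'I_r.+1,
    (i < j)%N && ((j <= q)%N || (q < i)%N) ==> (tau i < tau j)%N].

(* f (.) g, of degree r = p+q; r is a separate argument because p+q and q+p
   are not convertible, and the definition is only meant for r = p+q. *)
Definition circ (r p q : nat) (f : precochain p) (g : precochain q) :
    precochain r := fun x =>
  \sum_(tau : 'S_r.+1 | shuffle q tau)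
    let l (i : nat) := lam (tau (inord i)) in
    let y (i : nat) := x (tau (inord i)) in
    (-1) ^+ odd_perm tau *:
    vextend (fun i : 'I_q => l i)
      (fun u =>
         vsubst (fun j : 'I_p =>
                   if j == 0 :> nat then \sum_(i < q.+1) l i else l (q + j)%N)
           (f [ffun j : 'I_p.+1 =>
                 if j == 0 :> nat then u else iter q alpha (y (q + j)%N)]))
      (g [ffun i : 'I_q.+1 => y i]).

(* The signs are those of arities m = p+1 and n = q+1. *)
Definition NR (p q : nat) (f : precochain p) (g : precochain q) :
    precochain (p + q) := fun x =>
  circ f g x - (-1) ^+ (p * q) *: circ g f x.

(* C^*_alpha(L, L): families (c_k)_k with c_k in C^(k+1) and almost all c_k
   zero. *)
Definition graded : Type := forall k, precochain k.

Record in_Cstar (c : graded) : Prop := {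
  Cstar_cochain : forall k, is_cochain (c k);
  Cstar_finite : exists N, forall k, (N <= k)%N -> forall x, c k x = 0
}.

(* C^n as a subspace of C^*. *)
Record in_Cn (n : nat) (c : graded) : Prop := {
  Cn_Cstar : in_Cstar c;
  Cn_homog : forall k, k.+1 != n -> forall x, c k x = 0
}.

Definition gcomb (a : F) (c c' : graded) : graded :=
  fun k x => a%:P%:MP *: c k x + c' k x.

Definition m_c (br : L -> L -> vpoly L 1) : precochain 1 :=
  fun x => br (x ord0) (x ord_max).

(* [m, -]_NR on C^* for m in C^2; in arity 1 the value vanishes, C^0 being
   absent. *)
Definition d_NR (m : precochain 1) (c : graded) : graded := fun k =>
  match k return precochain k with
  | 0 => fun=> 0
  | k'.+1 => NR m (c k')
  end.

End Cochains.

Fact vsubst_id k (P : vpoly L k) : vsubst (fun i => 'X_i) P = P.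
Proof.
rewrite [RHS]vpolyE /vsubst /vextend; apply: eq_bigr => m _.
have -> : \prod_i 'X_i ^+ m i = 1 *: 'X_[m] :> mpoly k {poly F}.
  by rewrite scale1r [RHS]mpolyXE_id.
by rewrite [LHS]vscale_mon addm0 scale1r.
Qed.

Fact S2 (t : 'S_2) : t = 1%g \/ t = tperm ord0 ord_max.
Proof.
have H (i : 'I_2) : i = ord0 \/ i = ord_max.
  by case: i => [[|[|]]] // H; [left|right]; apply: val_inj.
case: (H (t ord0)) => t0; [left|right]; apply/permP => i; rewrite ?perm1.
  case: (H i) => -> //; case: (H (t ord_max)) => // e.
  by move: (perm_inj (etrans t0 (esym e))).
case: (H i) => ->; rewrite ?tpermL ?tpermR //; case: (H (t ord_max)) => // e.
by move: (perm_inj (etrans t0 (esym e))).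
Qed.

Fact m_c_cochain (br : L -> L -> vpoly L 1) (alpha : L -> L) :
  is_hom_lie_conformal br alpha -> multiplicative_hlc br alpha ->
  is_cochain alpha (m_c br).
Proof.
case=> l1 l2 _ _ p1 p2 sk _ hm.
have H (i : 'I_2) : i = ord0 \/ i = ord_max.
  by case: i => [[|[|]]] // H; [left|right]; apply: val_inj.
split.
- by move=> x i c u v; rewrite /m_c !ffunE; case: (H i) => -> /=; [exact: l1|exact: l2].
- by move=> x; rewrite /m_c hm !ffunE.
- move=> x i; rewrite (ord1 i) /m_c.
  have -> : lift ord_max ord0 = ord0 :> 'I_2 by apply: val_inj.
  by rewrite !ffunE /= p1.
- by move=> x; rewrite /m_c !ffunE /= big_ord1 p2.
- move=> t x; rewrite /m_c !ffunE.
  have e0 : lift ord_max ord0 = ord0 :> 'I_2 by apply: val_inj.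
  case: (S2 t) => ->.
    rewrite odd_perm1 expr0 scale1r !perm1.
    rewrite -[LHS]vsubst_id; apply: eq_bigr => m _; congr (_ *: _).
    by apply: eq_bigr => i _; rewrite perm1 /lam liftK.
  rewrite odd_tperm expr1 scaleN1r sk tpermL tpermR.
  apply: (congr1 -%R).
  apply: eq_bigr => m _; congr (_ *: _).
  apply: eq_bigr => i _; rewrite (ord1 i) e0 tpermL /lam.
  by rewrite unlift_none big_ord1.
Qed.

End Conformal.

Arguments lam {F} [r] j.
Arguments gcomb [F L] a c c' k _.
Arguments d_NR [F L] alpha m c k _.

(* Main.v *)
(* A cochain evaluated at arguments x_i with parameters l_i, and composed with
   a map [h] killing d + l_1 + ... + l_n, becomes an honest alternating function
   of the pairs (l_i, x_i), and circ becomes composition followed by a sum over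
   shuffles.  As the characteristic is 0, that sum is, up to a factorial, the
   alternating sum over all permutations, in which nested sums can be absorbed.
   This shows that circ preserves cochains and yields the graded pre-Lie identity
     (f.g).e - f.(g.e) = (-1)^(|g||e|) ((f.e).g - f.(e.g)),
   both sides being the alternation of f(g(...), e(...), ...).  The Hom-Jacobi
   identity says m.m = 0; for m odd, the pre-Lie identity then gives
   [m, [m, f]] = 0. *)
Require Import Defs.
From mathcomp Require Import all_boot all_order all_fingroup all_algebra.
From mathcomp Require Import monalg mpoly.
From mathcomp Require Import zify ring.
From Stdlib Require Import FunctionalExtensionality.
Set Implicit Arguments.
Unset Strict Implicit.
Unset Printing Implicit Defensive.
Import GRing.Theory.
Local Open Scope ring_scope.

(** * Alternating sums over functions of sequences *)

Section NatPerm.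

(** The convention for the last variable singles out one argument and involves d acting on the total
    value, while in a composition the inner and outer total values differ. On a target where d
    equals minus the sum of all parameters both obstacles disappear: the last parameter is
    determined by an equation symmetric in all of them, and the outer cochain, as a function of the
    value of the inner one, is again such a test map, now for the sum of the inner parameters.
    Nested compositions can thus be treated like single cochains. Points are indexed by all of [nat]
    and permutations are extended by the identity, because arities such as p+q and q+p are not
    convertible: no casts are needed when blocks of different lengths are moved. Identities between
    shuffle sums are proved after multiplication by factorials, which are cancelled at the end. In
    comparing f(g(...), e(...), ...) with its mirror image, the powers of alpha sit outside one
    inner cochain and inside the other; compatibility of cochains with alpha moves them through. *)

Definition perm_nat n (tau : 'S_n) (i : nat) : nat :=
  if insub i is Some j then tau j else i.

Lemma perm_nat_ord n (tau : 'S_n) (i : 'I_n) : perm_nat tau i = tau i.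
Proof. by rewrite /perm_nat valK. Qed.

Lemma perm_nat_out n (tau : 'S_n) i : (n <= i)%N -> perm_nat tau i = i.
Proof. by move=> ni; rewrite /perm_nat insubF // ltnNge ni. Qed.

Lemma perm_nat_lt n (tau : 'S_n) i : (perm_nat tau i < n)%N = (i < n)%N.
Proof.
case: (ltnP i n) => [lt_in|le_ni]; last by rewrite perm_nat_out // ltnNge le_ni.
by rewrite (perm_nat_ord tau (Ordinal lt_in)) ltn_ord.
Qed.

Lemma perm_nat_inord n (tau : 'S_n.+1) i : (i < n.+1)%N -> perm_nat tau i = tau (inord i).
Proof. by move=> lt_in; rewrite -perm_nat_ord inordK. Qed.

Lemma perm_nat1 n i : perm_nat (1%g : 'S_n) i = i.
Proof. by rewrite /perm_nat; case: insubP => // j _ <-; rewrite perm1. Qed.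

Lemma perm_natM n (s t : 'S_n) i : perm_nat (s * t)%g i = perm_nat t (perm_nat s i).
Proof.
case: (ltnP i n) => [lt_in|le_ni]; last by rewrite !perm_nat_out.
by rewrite -[i]/(val (Ordinal lt_in)) !perm_nat_ord permM.
Qed.

Lemma perm_nat_tperm n (x y : 'I_n) i :
  perm_nat (tperm x y) i = if i == x then val y else if i == y then val x else i.
Proof.
case: (ltnP i n) => [lt_in|le_ni].
  rewrite -[i]/(val (Ordinal lt_in)) perm_nat_ord !val_eqE.
  case: tpermP => [->|->|/eqP/negPf-> /eqP/negPf->] //; rewrite eqxx //.
  by case: eqP => // ->.
rewrite perm_nat_out //; case: eqP => [e|_]; last case: eqP => [e|//].
  by move: le_ni; rewrite e leqNgt ltn_ord.
by move: le_ni; rewrite e leqNgt ltn_ord.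
Qed.

(* The sign of the permutation is [(-1)^b]. *)
Definition nat_perm n (b : bool) (phi : nat -> nat) : Prop :=
  exists2 tau : 'S_n, odd_perm tau = b & forall i, phi i = perm_nat tau i.

Lemma nat_perm_eq n b phi psi :
  (forall i, phi i = psi i) -> nat_perm n b phi -> nat_perm n b psi.
Proof. by move=> e [tau ob tauE]; exists tau => // i; rewrite -e. Qed.

Lemma nat_perm_id n : nat_perm n false id.
Proof. by exists 1%g => [|i]; rewrite ?odd_perm1 ?perm_nat1. Qed.

Lemma nat_perm_comp n b c phi psi :
  nat_perm n b phi -> nat_perm n c psi -> nat_perm n (b (+) c) (phi \o psi).
Proof.
move=> [s <- sE] [t <- tE]; exists (t * s)%g => [|i] /=.
  by rewrite odd_permM addbC.
by rewrite perm_natM sE tE.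
Qed.

Definition swap (x y i : nat) := if i == x then y else if i == y then x else i.

Lemma nat_perm_swap n x y : (x < n)%N -> (y < n)%N -> x != y ->
  nat_perm n true (swap x y).
Proof.
move=> xn yn xy; exists (tperm (Ordinal xn) (Ordinal yn)) => [|i].
  by rewrite odd_tperm -val_eqE.
by rewrite perm_nat_tperm.
Qed.

Definition offset (a : nat) (phi : nat -> nat) (i : nat) :=
  if (i < a)%N then i else (a + phi (i - a))%N.


(** Shifting turns a transposition into a transposition, so the sign survives; hence the induction
    on a decomposition into transpositions. The case [a = 0] embeds the permutations of n letters
    into those of N letters. *)
Lemma nat_perm_offset N n a b phi : (a + n <= N)%N ->
  nat_perm n b phi -> nat_perm N b (offset a phi).
Proof.
move=> anN [tau <- phiE].
suff [rho oddE rhoE] : nat_perm N tau (offset a (perm_nat tau)).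
  by exists rho => // i; rewrite -rhoE /offset phiE.
have [ts -> {phi tau phiE}] := prod_tpermP tau.
elim: ts => [_|[x y] ts IH /= /andP[xy /IH {}IH]].
  rewrite big_nil odd_perm1; apply: nat_perm_eq (nat_perm_id N) => i.
  by rewrite /offset perm_nat1; case: ltnP => // /subnKC.
rewrite big_cons odd_mul_tperm xy -[true (+) _]addbC.
apply: nat_perm_eq (nat_perm_comp IH (nat_perm_swap (x := a + x) (y := a + y) _ _ _)).
- move=> i /=; rewrite /offset perm_natM perm_nat_tperm /swap.
  case: (ltnP i a) => [lt_ia|le_ai].
    have neq z : (i == a + z)%N = false.
      by rewrite ltn_eqF // (leq_trans lt_ia) ?leq_addr.
    by rewrite !neq lt_ia.
  have eqE z : (i == a + z)%N = (i - a == z)%N.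
    by rewrite -{1}(subnKC le_ai) eqn_add2l.
  rewrite !eqE; case: eqP => _; last case: eqP => _.
  - by rewrite ltnNge leq_addr addKn.
  - by rewrite ltnNge leq_addr addKn.
  - by rewrite ltnNge le_ai.
- by apply: leq_trans anN; rewrite ltn_add2l.
- by apply: leq_trans anN; rewrite ltn_add2l.
- by rewrite eqn_add2l.
Qed.

(** The cycle of length a+2 is the cycle of length a+1 composed with one transposition of the last
    two letters. *)
Lemma nat_perm_cycle a :
  nat_perm a.+1 (odd a) (fun i => if (i < a)%N then i.+1 else if i == a then 0%N else i).
Proof.
elim: a => [|a IH].
  by apply: nat_perm_eq (nat_perm_id 1) => i; rewrite ltn0; case: eqP.
have IH' : nat_perm a.+2 (odd a) _ := nat_perm_offset (a := 0) (leqnSn _) IH.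
have sw : nat_perm a.+2 true (swap a a.+1) by apply: nat_perm_swap; rewrite // neq_ltn ltnSn.
rewrite -[odd a.+1]addbT; apply: nat_perm_eq (nat_perm_comp IH' sw) => i /=.
rewrite /offset /swap /= !add0n !subn0.
by do ?[case: eqP => ?]; do ?[case: ltnP => ?]; lia.
Qed.

(** Induction on b: the new last letter passes over the a letters of the first block, which is a
    shifted cycle of sign (-1)^a. *)
Lemma nat_perm_block a b : nat_perm (a + b) (odd (a * b))
  (fun i => if (i < a)%N then (b + i)%N else if (i < a + b)%N then (i - a)%N else i).
Proof.
elim: b => [|b IH].
  rewrite muln0 addn0; apply: nat_perm_eq (nat_perm_id a) => i.
  by case: ltnP => // le_ai; rewrite ltnNge le_ai.
have IH' : nat_perm (a + b.+1) (odd (a * b)) _ :=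
  nat_perm_offset (a := 0) (leq_add (leqnn a) (leqnSn b)) IH.
have le_ba : (b + a.+1 <= a + b.+1)%N by lia.
have cyc : nat_perm (a + b.+1) (odd a) _ := nat_perm_offset le_ba (nat_perm_cycle a).
rewrite mulnS oddD; apply: nat_perm_eq (nat_perm_comp cyc IH').
move=> i /=; rewrite /offset /= !add0n !subn0.
case: (ltnP i a) => ?; case: (ltnP i (a + b)) => ? //=;
  by do ?[case: ltnP => ?]; do ?[case: eqP => ?]; lia.
Qed.

End NatPerm.

(** * Alternating sums over all permutations *)

Section Alternation.
Variables (K : pzRingType) (P : Type) (V : lmodType K).
Implicit Types (T : (nat -> P) -> V) (t : nat -> P).

Definition alt n T t : V :=
  \sum_(tau : 'S_n) (-1) ^+ odd_perm tau *: T (fun i => t (perm_nat tau i)).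

Lemma signZK (b : bool) (v : V) : (-1) ^+ b *: ((-1) ^+ b *: v) = v.
Proof. by rewrite scalerA -signr_addb addbb expr0 scale1r. Qed.

Lemma eq_alt n T T' t : (forall tau : 'S_n,
    T (fun i => t (perm_nat tau i)) = T' (fun i => t (perm_nat tau i))) ->
  alt n T t = alt n T' t.
Proof. by move=> TT'; apply: eq_bigr => tau _; rewrite TT'. Qed.

Lemma alt_sum (I : finType) n (T : I -> (nat -> P) -> V) (c : I -> K) t :
  (forall i (b : bool), GRing.comm (c i) ((-1) ^+ b)) ->
  alt n (fun s => \sum_i c i *: T i s) t = \sum_i c i *: alt n (T i) t.
Proof.
move=> cC; rewrite /alt; under eq_bigr do rewrite scaler_sumr.
rewrite exchange_big; apply: eq_bigr => i _; rewrite scaler_sumr.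
by apply: eq_bigr => tau _; rewrite !scalerA cC.
Qed.

Lemma alt_sign n T (b : bool) t :
  alt n (fun s => (-1) ^+ b *: T s) t = (-1) ^+ b *: alt n T t.
Proof.
rewrite /alt scaler_sumr; apply: eq_bigr => tau _.
by rewrite !scalerA -!signr_addb addbC.
Qed.

Lemma altD n T T' t : alt n (fun s => T s + T' s) t = alt n T t + alt n T' t.
Proof. by rewrite /alt -big_split; apply: eq_bigr => tau _; rewrite scalerDr. Qed.

Lemma altN n T t : alt n (fun s => - T s) t = - alt n T t.
Proof. by rewrite /alt -sumrN; apply: eq_bigr => tau _; rewrite scalerN. Qed.

Lemma altMn n T k t : alt n (fun s => T s *+ k) t = alt n T t *+ k.
Proof. by rewrite /alt -sumrMnl; apply: eq_bigr => tau _; rewrite scalerMnr. Qed.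

(** This is how nested sums are absorbed: permuting the positions read by [T] translates the
    summation index on the left. In [alt_arg_nat_perm] the argument is permuted instead, which
    translates it on the right. *)
Lemma alt_nat_perm n b phi T t : nat_perm n b phi ->
  alt n (fun s => T (fun i => s (phi i))) t = (-1) ^+ b *: alt n T t.
Proof.
move=> [rho <- phiE]; rewrite /alt scaler_sumr (reindex_inj (mulgI rho^-1%g)) /=.
apply: eq_bigr => tau _; rewrite scalerA odd_permM odd_permV signr_addb.
congr (_ *: T _); apply: functional_extensionality => i.
by rewrite phiE -perm_natM mulKVg.
Qed.

Lemma alt_arg_nat_perm n b phi T t : nat_perm n b phi ->
  alt n T (fun i => t (phi i)) = (-1) ^+ b *: alt n T t.
Proof.
move=> [rho <- phiE]; rewrite /alt scaler_sumr (reindex_inj (mulIg rho^-1%g)) /=.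
apply: eq_bigr => tau _; rewrite scalerA odd_permM odd_permV addbC signr_addb.
congr (_ *: T _); apply: functional_extensionality => i.
by rewrite phiE -perm_natM mulgKV.
Qed.

End Alternation.

(** * Sums over shuffles *)

Section Shuffle.
Variables (r q : nat).
Hypothesis le_qr : (q <= r)%N.
Implicit Types (rho sigma tau : 'S_r.+1) (i j : 'I_r.+1).

Let block : {set 'I_r.+1} := [set i : 'I_r.+1 | (i <= q)%N].

(** The Young subgroup of the two blocks of positions. Shuffles are shown to be a transversal of its
    right cosets. *)
Let young : {set 'S_r.+1} := (Sym block * Sym (~: block))%g.

Let youngP rho : reflect (forall i, (rho i <= q)%N = (i <= q)%N) (rho \in young).
Proof.
apply: (iffP idP) => [/mulsgP[s t] /[!inE] sB tB -> i|rhoB].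
  rewrite permM; have := perm_closed i sB; have := perm_closed (s i) tB.
  rewrite !inE => /(congr1 negb); rewrite !negbK => -> //.
have nB (S : {set 'I_r.+1}) : S \in [:: block; ~: block] -> rho \in ('N(S | 'P))%g.
  move=> SB; rewrite !inE; apply/subsetP => i; move: SB; rewrite !inE /=.
  by case/orP => /eqP ->; rewrite !inE /= /aperm rhoB.
apply/mulsgP; exists (restr_perm block rho) (restr_perm (~: block) rho).
- by rewrite inE restr_perm_on.
- by rewrite inE restr_perm_on.
apply/permP => i; rewrite permM; case: (boolP (i \in block)) => iB.
  rewrite (restr_permE _ iB) ?nB ?inE ?eqxx //.
  by rewrite (out_perm (restr_perm_on _ _)) // !inE rhoB negbK; rewrite inE in iB.
rewrite (out_perm (restr_perm_on _ _) iB) restr_permE ?nB ?inE ?eqxx ?orbT //.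
by rewrite inE in iB.
Qed.

Let card_young : #|young| = (q.+1`! * (r - q)`!)%N.
Proof.
have cB : #|block| = q.+1.
  rewrite -sum1_card (eq_bigl (fun i : 'I_r.+1 => (i < q.+1)%N)) => [|i].
    by rewrite -(big_ord_widen r.+1 (fun=> 1%N)) // sum1_card card_ord.
  by rewrite inE.
have cB' : #|~: block| = (r - q)%N by rewrite cardsCs setCK card_ord cB subSS.
rewrite TI_cardMg ?card_Sym ?cB ?cB' //; apply/trivgP/subsetP => s; rewrite !inE.
case/andP => sB sB'; apply/eqP/permP => i; rewrite perm1.
case: (boolP (i \in block)) => iB; last exact: out_perm sB iB.
by rewrite (out_perm sB') // !inE negbK; rewrite inE in iB.
Qed.

Let young_group : group_set young.
Proof.
apply/group_setP; split => [|s t /youngP sY /youngP tY]; apply/youngP => i.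
  by rewrite perm1.
by rewrite permM tY sY.
Qed.

Let youngG := Group young_group.

Let shuffleP tau : reflect
  (forall i j, (i < j)%N -> (i <= q)%N = (j <= q)%N -> (tau i < tau j)%N)
  (shuffle q tau).
Proof.
apply: (iffP 'forall_forallP) => H i j; last first.
  by apply/implyP => /andP[lt_ij ij]; apply: H => //; lia.
by move=> lt_ij ij; apply: (implyP (H i j)); rewrite lt_ij /=; lia.
Qed.

(** Here [rho] is increasing: inside a block because both [sigma] and [rho * sigma] are, across
    blocks because [rho] preserves them. Applied to [rho] and its inverse, this forces [rho = 1]. *)
Let shuffle_le sigma rho i : shuffle q sigma -> shuffle q (rho * sigma)%g ->
  rho \in young -> (i <= rho i)%N.
Proof.
move=> /shuffleP Hs /shuffleP Hrs /youngP rhoB.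
have mono i1 i2 : (i1 < i2)%N -> (rho i1 < rho i2)%N.
  move=> lt12; case: (boolP ((i1 <= q) == (i2 <= q))%N) => [/eqP eq12|ne12].
    have := Hrs _ _ lt12 eq12; rewrite !permM => lt_s.
    case: (ltngtP (rho i1) (rho i2)) => // [lt21|/val_inj e].
      by have := Hs _ _ lt21; rewrite !rhoB eq12 => /(_ erefl); lia.
    by move: lt_s; rewrite e ltnn.
  by have := rhoB i1; have := rhoB i2; lia.
have [m] := ubnP (i : nat); elim: m i => // m IH [[//|i] lti] /= lt_im.
have /IH/= := lt_im : (Ordinal (ltnW lti) < m)%N.
by have := @mono (Ordinal (ltnW lti)) (Ordinal lti) (ltnSn _); lia.
Qed.

Let shuffle_uniq sigma tau : shuffle q sigma -> shuffle q tau ->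
  (tau * sigma^-1)%g \in young -> tau = sigma.
Proof.
move=> Hs Ht; set rho := (tau * _)%g => rhoY.
have tauE : tau = (rho * sigma)%g by rewrite mulgKV.
have sE : sigma = (rho^-1 * tau)%g by rewrite tauE mulKg.
suff rho1 : rho = 1%g by rewrite tauE rho1 mul1g.
apply/permP => i; apply: val_inj; rewrite perm1 /=; apply/eqP.
rewrite eqn_leq (@shuffle_le sigma) -?tauE // andbT.
have := @shuffle_le tau rho^-1 (rho i) Ht; rewrite -sE permK; apply => //.
exact: (@groupVr _ youngG).
Qed.

Variables (V : zmodType) (G : 'S_r.+1 -> V).
Hypothesis G_block : forall i j sigma, (i <= q)%N = (j <= q)%N ->
  G (tperm i j * sigma)%g = G sigma.

(** By the rearrangement inequality this sum grows when an inversion inside a block is undone, so a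
    maximizer in a coset is a shuffle. *)
Let potential sigma := (\sum_(i : 'I_r.+1) i * sigma i)%N.

Let potential_swap i j sigma : (i < j)%N -> (sigma j < sigma i)%N ->
  (potential sigma < potential (tperm i j * sigma)%g)%N.
Proof.
move=> lt_ij lt_s; rewrite /potential.
have ji : j != i by rewrite -val_eqE gtn_eqF.
rewrite (bigD1 i) // (bigD1 j) //= [X in (_ < X)%N](bigD1 i) // (bigD1 j) //=.
rewrite !permM tpermL tpermR !addnA.
rewrite [X in (_ < _ + X)%N](eq_bigr (fun k : 'I_r.+1 => (k * sigma k)%N)); last first.
  by move=> k /andP[ki kj]; rewrite permM tpermD // eq_sym.
by rewrite ltn_add2r; nia.
Qed.

Let exists_shuffle tau : exists2 sigma, shuffle q sigma &
  (sigma * tau^-1)%g \in young /\ G sigma = G tau.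
Proof.
(* Equality of [G] is carried along the maximization, as invariance is given for one transposition
   at a time. *)
pose C sigma := ((sigma * tau^-1)%g \in young) && (G sigma == G tau).
have Ctau : C tau by rewrite /C mulgV (@group1 _ youngG) eqxx.
case: (arg_maxnP potential Ctau) => sigma /andP[sY /eqP sG] sigma_max.
exists sigma => //; apply/shuffleP => i j lt_ij ij; rewrite ltnNge; apply/negP => le_s.
have lt_s : (sigma j < sigma i)%N.
  rewrite ltn_neqAle le_s andbT; apply/eqP => /val_inj/perm_inj e.
  by move: lt_ij; rewrite e ltnn.
have := potential_swap lt_ij lt_s; rewrite ltnNge => /negP; apply; apply: sigma_max.
rewrite /C G_block // sG eqxx andbT -mulgA (@groupM _ youngG) //.
by apply/youngP => k; case: tpermP => [->|->|].
Qed.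

(** [G] is constant on each right coset of the Young subgroup, and each coset contains exactly one
    shuffle; the factor is the order of the subgroup. *)
Lemma sum_shuffle :
  \sum_sigma G sigma = (\sum_(sigma | shuffle q sigma) G sigma) *+ (q.+1`! * (r - q)`!).
Proof.
pose sh tau := odflt tau [pick sigma | shuffle q sigma && ((sigma * tau^-1)%g \in young)].
have shP tau : shuffle q (sh tau) /\ (sh tau * tau^-1)%g \in young.
  rewrite /sh; case: pickP => [sigma /andP[] //|no].
  by have [sigma s1 [s2 _]] := exists_shuffle tau; move: (no sigma); rewrite s1 s2.
rewrite (partition_big sh (shuffle q)) => [|tau _]; last by case: (shP tau).
rewrite -sumrMnl; apply: eq_bigr => sigma Hsigma.
have shE tau : (sh tau == sigma) = ((tau * sigma^-1)%g \in young).
  have [Hsh shY] := shP tau; apply/eqP/idP => [<-|tauY].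
    by have := @groupVr _ youngG _ shY; rewrite invMg invgK.
  apply: shuffle_uniq => //.
  have -> : (sh tau * sigma^-1 = (sh tau * tau^-1) * (tau * sigma^-1))%g.
    by rewrite mulgA mulgKV.
  exact: (@groupM _ youngG).
rewrite (eq_bigl _ _ shE) (eq_bigr (fun=> G sigma)) => [|tau tauY]; last first.
  have [s s1 [s2 <-]] := exists_shuffle tau; congr G; apply: shuffle_uniq => //.
  have -> : (s * sigma^-1 = (s * tau^-1) * (tau * sigma^-1))%g by rewrite mulgA mulgKV.
  exact: (@groupM _ youngG).
rewrite sumr_const -card_young; congr (_ *+ _).
by rewrite -(card_rcoset young sigma); apply: eq_card => tau; rewrite mem_rcoset.
Qed.

End Shuffle.

(** * Evaluation of polynomials with vector coefficients *)

Section Evaluation.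
Variables (F : fieldType) (L : lmodType {poly F}).
Variables (K : comNzRingType) (iota : {rmorphism F -> K}) (W : lmodType K).
Implicit Types (A : K) (h : L -> W).

(** The variable ['X] is the action of d, which becomes [- A] on a target where d + A acts as
    zero. *)
Definition evp A : {rmorphism {poly F} -> K} := horner_morph (fun c => mulrC (- A) (iota c)).

Lemma evpC A c : evp A c%:P = iota c.
Proof. exact: horner_morphC. Qed.

Lemma evpX A : evp A 'X = - A.
Proof. exact: horner_morphX. Qed.

Definition ev k (E : 'I_k -> K) A : {rmorphism mpoly k {poly F} -> K} := mmap (evp A) E.

Lemma evC k (E : 'I_k -> K) A p : ev E A p%:MP = evp A p.
Proof. exact: mmapC. Qed.

Lemma evX k (E : 'I_k -> K) A i : ev E A 'X_i = E i.
Proof. by rewrite /= mmapX mmap1U. Qed.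

Lemma ev_mon k (E : 'I_k -> K) A p m :
  ev E A (p *: 'X_[m]) = evp A p * \prod_i E i ^+ m i.
Proof. by rewrite [LHS]mmapZ mmapX. Qed.

(* [h] kills [d + A], i.e. it factors through [L (x)_C K / (d + A)]. *)
Definition weight_hom A h : Prop := forall p u v, h (p *: u + v) = evp A p *: h u + h v.

Lemma weight_hom_scale_add A h :
    (forall c u v, h (c%:P *: u + v) = iota c *: h u + h v) ->
    (forall u, h ('X *: u) = - A *: h u) ->
  weight_hom A h.
Proof.
move=> hC hX p u v.
have h0 : h 0 = 0.
  by have /esym/eqP := hC 1 0 0; rewrite scaler0 addr0 (rmorph1 iota) scale1r -subr_eq0 addrK =>
    /eqP.
have hD u1 u2 : h (u1 + u2) = h u1 + h u2.
  by have := hC 1 u1 u2; rewrite polyC1 rmorph1 !scale1r.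
rewrite hD; congr (_ + _); elim/poly_ind: p => [|p c IH] in u *.
  by rewrite rmorph0 !scale0r.
have -> : (p * 'X + c%:P) *: u = p *: ('X *: u) + c%:P *: u by rewrite scalerDl scalerA.
rewrite hD IH hX scalerA.
have -> : h (c%:P *: u) = iota c *: h u by have := hC c u 0; rewrite h0 !addr0.
by rewrite -scalerDl rmorphD rmorphM evpX evpC.
Qed.

Section Whom.
Variables (A : K) (h : L -> W).
Hypothesis Ah : weight_hom A h.

Lemma weight_homD : {morph h : u v / u + v}.
Proof. by move=> u v; have := Ah 1 u v; rewrite scale1r rmorph1 scale1r. Qed.

Lemma weight_hom0 : h 0 = 0.
Proof. by apply: (addrI (h 0)); rewrite -weight_homD !addr0. Qed.

Lemma weight_homZ p u : h (p *: u) = evp A p *: h u.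
Proof. by have := Ah p u 0; rewrite weight_hom0 !addr0. Qed.

End Whom.

(* [vextend] with values in an arbitrary module: in a composition of cochains,
   [h] is the outer cochain as a function of the value of the inner one. *)
Definition vext k (E : 'I_k -> K) h (P : vpoly L k) : W :=
  \sum_(m <- vsupp P) (\prod_i E i ^+ m i) *: h (vcoef m P).

Section Extend.
Variables (k : nat) (E : 'I_k -> K).
Implicit Types (P Q : vpoly L k).

Lemma vext_mon h m x : h 0 = 0 ->
  vext E h (vmon m x) = (\prod_i E i ^+ m i) *: h x.
Proof.
move=> h0.
apply: (vsum_mon (h := fun m' y => (\prod_i E i ^+ m' i) *: h y)) => m'.
by rewrite h0 scaler0.
Qed.

Lemma vextD h P Q : {morph h : x y / x + y} ->
  vext E h (P + Q) = vext E h P + vext E h Q.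
Proof.
move=> hD.
by apply: (vsumD (h := fun m y => (\prod_i E i ^+ m i) *: h y)) => m x y; rewrite hD scalerDr.
Qed.

Lemma vext0 h : vext E h 0 = 0.
Proof. by rewrite /vext /vsupp monalg.msupp0 finmap.big_seq_fset0. Qed.

(** The purpose of [weight_hom]: it makes the extension of [h] to polynomials semilinear along
    [ev E A], so coefficients containing d can be pulled out. *)
Lemma vext_scale A h P (a : mpoly k {poly F}) : weight_hom A h ->
  vext E h (a *: P) = ev E A a *: vext E h P.
Proof.
move=> Ah; have hD := weight_homD Ah; have h0 := weight_hom0 Ah.
elim/vpoly_ind: P => [|m x|P Q IHP IHQ].
- by rewrite scaler0 vext0 scaler0.
- rewrite [in RHS](vext_mon _ _ h0).
  elim/mpoly_ind_monomials: a => [|p a|a b IHa IHb].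
  + by rewrite scale0r rmorph0 scale0r vext0.
  + apply: etrans (congr1 (vext E h) (vscale_mon p a m x)) _.
    rewrite (vext_mon _ _ h0) (weight_homZ Ah) !scalerA ev_mon -mulrA mulrC.
    by congr (_ * _ *: _); rewrite -big_split; apply: eq_bigr => i _ /=; rewrite mnmDE exprD.
  + rewrite scalerDl; apply: etrans (vextD _ _ hD) _.
    by apply: etrans (f_equal2 +%R IHa IHb) _; rewrite -scalerDl -(rmorphD (ev E A)).
- rewrite scalerDr; apply: etrans (vextD _ _ hD) _.
  apply: etrans (f_equal2 +%R IHP IHQ) _; rewrite -scalerDr; congr (_ *: _).
  by apply/esym/vextD.
Qed.

Lemma eq_vext (E' : 'I_k -> K) h h' P : E =1 E' -> h =1 h' ->
  vext E h P = vext E' h' P.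
Proof.
move=> EE' hh'; apply: eq_bigr => m _; rewrite hh'; congr (_ *: _).
by apply: eq_bigr => i _; rewrite EE'.
Qed.

Lemma vext_sum (I : finType) (c : I -> K) (h : I -> L -> W) P (S : pred I) :
  vext E (fun u => \sum_(i | S i) c i *: h i u) P = \sum_(i | S i) c i *: vext E (h i) P.
Proof.
rewrite /vext; under eq_bigr do rewrite scaler_sumr.
rewrite exchange_big; apply: eq_bigr => i _; rewrite scaler_sumr.
by apply: eq_bigr => m _; rewrite !scalerA mulrC.
Qed.

Lemma vext_sumr A h (I : Type) (s : seq I) (S : pred I)
    (c : I -> mpoly k {poly F}) (P : I -> vpoly L k) : weight_hom A h ->
  vext E h (\sum_(i <- s | S i) c i *: P i) =
  \sum_(i <- s | S i) ev E A (c i) *: vext E h (P i).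
Proof.
move=> Ah; apply: (big_rec2 (fun x y => vext E h x = y)) => [|i x y _ <-].
  exact: vext0.
apply: etrans (vextD _ _ (weight_homD Ah)) _; congr (_ + _); exact: vext_scale.
Qed.

Lemma vext_vmap A h g P : weight_hom A h -> g 0 = 0 -> {morph g : x y / x + y} ->
  vext E h (vmap g P) = vext E (h \o g) P.
Proof.
move=> Ah g0 gD.
have mapD (Q R : vpoly L k) : vmap g (Q + R) = vmap g Q + vmap g R.
  apply: (vsumD (h := fun m y => vmon m (g y))) => m x y.
  by rewrite gD; exact: vmonD.
have h0 := weight_hom0 Ah; have hD := weight_homD Ah.
elim/vpoly_ind: P => [|m x|P Q IHP IHQ].
- by rewrite [vmap g 0]/vmap /vsupp monalg.msupp0 finmap.big_seq_fset0 !vext0.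
- have -> : vmap g (vmon m x) = vmon m (g x) :> vpoly L k.
    by apply: (vsum_mon (h := fun m' y => vmon m' (g y))) => m'; rewrite g0 vmon0.
  by rewrite (vext_mon _ _ h0) [RHS]vext_mon //= g0.
- rewrite mapD; apply: etrans (vextD _ _ hD) _.
  apply: etrans (f_equal2 +%R IHP IHQ) _; apply/esym/vextD => x y /=.
  by rewrite gD hD.
Qed.

End Extend.

Lemma vext_swap j k (E : 'I_j -> K) (B : 'I_k -> K) (h : L -> L -> W) P Q :
  vext E (fun u => vext B (h u) Q) P = vext B (fun v => vext E (h^~ v) P) Q.
Proof.
rewrite /vext; under eq_bigr do rewrite scaler_sumr.
rewrite exchange_big; apply: eq_bigr => m _; rewrite scaler_sumr.
by apply: eq_bigr => m' _; rewrite !scalerA mulrC.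
Qed.

End Evaluation.

Section Value.
Variables (F : fieldType) (L : lmodType {poly F}).

Definition scal r : {rmorphism F -> mpoly r {poly F}} :=
  (@mpolyC r {poly F} : {rmorphism _ -> _}) \o polyC.

Definition value r : L -> vpoly L r := vmon 0%MM.

Lemma scale_value r p u : p%:MP *: value r u = value r (p *: u).
Proof.
have -> : p%:MP = p *: 'X_[0%MM] :> mpoly r {poly F} by rewrite mpolyX0 alg_mpolyC.
by apply: etrans (vscale_mon p _ _ _) _; rewrite addm0.
Qed.

(** The universal test map: in L[l_1, ..., l_r] the sum of all [lam j] is -d, because the last one
    is defined that way. *)
Lemma weight_hom_value r : weight_hom (scal r) (- 'X%:MP) (@value r).
Proof.
apply: weight_hom_scale_add => [c u v|u].
  apply: etrans (vmonD _ _ _) _; congr (_ + _); exact: esym (scale_value r c%:P u).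
by rewrite opprK scale_value.
Qed.

Variables (K : comNzRingType) (iota : {rmorphism F -> K}) (W : lmodType K).

Lemma vext_value k (E : 'I_k -> K) A (h : L -> W) u : weight_hom iota A h ->
  vext E h (value k u) = h u.
Proof.
move=> Ah; apply: etrans (vext_mon _ _ _ (weight_hom0 Ah)) _.
by rewrite big1 ?scale1r // => i _; rewrite mnm0E expr0.
Qed.

Lemma vext_vext j k (E : 'I_k -> K) (B : 'I_j -> mpoly k {poly F}) A
    (h : L -> W) (g : L -> vpoly L k) P : weight_hom iota A h ->
  vext E h (vext B g P) =
  vext (fun i => ev iota E A (B i)) (fun u => vext E h (g u)) P.
Proof.
move=> Ah; apply: etrans (vext_sumr _ _ _ _ _ Ah) _.
apply: eq_bigr => m _; rewrite rmorph_prod; congr (_ *: _).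
by apply: eq_bigr => i _; rewrite rmorphXn.
Qed.

End Value.

(** * Values of cochains *)

Definition seq_set (T : Type) (t : nat -> T) (i : nat) (a : T) (j : nat) :=
  if j == i then a else t j.

Definition seq_cons (T : Type) (a : T) (t : nat -> T) (j : nat) := if j is j'.+1 then t j' else a.

Section Points.
Variables (F : fieldType) (L : lmodType {poly F}).
Variables (K : comNzRingType) (iota : {rmorphism F -> K}) (W : lmodType K).
Local Notation point := (K * L)%type.
Implicit Types (A : K) (h : L -> W) (t : nat -> point).

(* The value of a conformal cochain at arguments [(t i).2] with parameters
   [(t i).1], pushed to [W] by [h].  The last parameter [(t p).1] is not used:
   it is determined by the others when [h] kills [d + weight p.+1 t]. *)
Definition at_points p (f : precochain L p) h t : W :=
  vext (fun i : 'I_p => (t i).1) h (f [ffun i : 'I_p.+1 => (t i).2]).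

Definition weight n t : K := \sum_(i < n) (t i).1.

Lemma eq_at_points p (f : precochain L p) h h' t t' :
  h =1 h' -> (forall i, (i <= p)%N -> t i = t' i) ->
  at_points f h t = at_points f h' t'.
Proof.
move=> hh' tt'; rewrite /at_points.
have -> : [ffun i : 'I_p.+1 => (t i).2] = [ffun i : 'I_p.+1 => (t' i).2].
  by apply/ffunP => i; rewrite !ffunE tt' // -ltnS.
by apply: eq_vext => // i; rewrite tt' // ltnW.
Qed.

Lemma eq_wt n t t' : (forall i, (i < n)%N -> (t i).1 = (t' i).1) -> weight n t = weight n t'.
Proof. by move=> tt'; apply: eq_bigr => i _; rewrite tt'. Qed.

Lemma weight_perm n (tau : 'S_n) t : weight n (fun i => t (perm_nat tau i)) = weight n t.
Proof.
rewrite /weight [RHS](reindex_inj (@perm_inj _ tau)) /=.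
by apply: eq_bigr => i _; rewrite perm_nat_ord.
Qed.

Lemma weight_nat_perm n b phi t : nat_perm n b phi -> weight n (fun i => t (phi i)) = weight n t.
Proof.
move=> [tau _ phiE]; rewrite -[RHS](weight_perm tau).
by apply: eq_wt => i _; rewrite phiE.
Qed.

Lemma lam_lift r (i : 'I_r) : lam (lift ord_max i) = 'X_i :> mpoly r {poly F}.
Proof. by rewrite /lam liftK. Qed.

Lemma lam_max r : lam ord_max = - (\sum_(i < r) 'X_i) - 'X%:MP :> mpoly r {poly F}.
Proof. by rewrite /lam unlift_none. Qed.

(** The last parameter joins the others here: d evaluates to minus the total weight, so -l_1 - ... -
    l_p - d becomes the weight minus the first p parameters. *)
Lemma ev_lam p t (j : 'I_p.+1) :
  ev iota (fun i : 'I_p => (t i).1) (weight p.+1 t) (lam j) = (t j).1.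
Proof.
case: (unliftP ord_max j) => [i ->|->]; first by rewrite lam_lift evX lift_max.
rewrite lam_max rmorphB rmorphN rmorph_sum evC evpX opprK /weight big_ord_recr /=.
rewrite addrA (eq_bigr (fun i : 'I_p => (t i).1)) ?addNr ?add0r // => i _.
exact: evX.
Qed.

Variable alpha : L -> L.
Hypothesis alpha_lin : forall p u v, alpha (p *: u + v) = p *: alpha u + alpha v.

Definition twist q (a : point) : point := (a.1, iter q alpha a.2).

Section Cochain.
Variables (p : nat) (f : precochain L p).
Hypothesis fC : is_cochain alpha f.

Lemma at_points_perm h t (tau : 'S_p.+1) : weight_hom iota (weight p.+1 t) h ->
  at_points f h (fun i => t (perm_nat tau i)) = (-1) ^+ odd_perm tau *: at_points f h t.
Proof.
move=> th; rewrite {2}/at_points (cochain_skew fC tau).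
rewrite (vext_scale _ _ _ th) rmorph_sign signZK.
have vsubstE k (B : 'I_k -> mpoly p {poly F}) P : vsubst B P = vext B (@value F L p) P by [].
rewrite vsubstE (vext_vext _ _ _ _ th) /at_points.
have -> : [ffun i : 'I_p.+1 => (t (perm_nat tau i)).2] =
    [ffun i => [ffun i0 : 'I_p.+1 => (t i0).2] (tau i)].
  by apply/ffunP => i; rewrite !ffunE perm_nat_ord.
apply: eq_vext => [i|u]; last by rewrite (vext_value _ _ th).
by rewrite ev_lam -perm_nat_ord lift_max.
Qed.

Lemma at_points_nat_perm h t b phi : weight_hom iota (weight p.+1 t) h ->
  nat_perm p.+1 b phi ->
  at_points f h (fun i => t (phi i)) = (-1) ^+ b *: at_points f h t.
Proof.
move=> th [tau <- phiE]; rewrite -at_points_perm //.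
by apply: eq_at_points => // i _; rewrite phiE.
Qed.

Lemma at_points_alpha h A t : weight_hom iota A h ->
  at_points f (fun u => h (alpha u)) t = at_points f h (fun i => twist 1 (t i)).
Proof.
move=> Ah; rewrite /at_points.
have -> : [ffun i : 'I_p.+1 => (twist 1 (t i)).2] =
    [ffun i => alpha ([ffun i : 'I_p.+1 => (t i).2] i)].
  by apply/ffunP => i; rewrite !ffunE.
rewrite -(cochain_alpha fC) (vext_vmap _ _ Ah) //.
  by rewrite -[X in alpha X](addr0 0) -{1}(scaler0 _ (-1)) alpha_lin scaleN1r addNr.
by move=> u v; have := alpha_lin 1 u v; rewrite !scale1r.
Qed.

Lemma weight_hom_alpha h A : weight_hom iota A h -> weight_hom iota A (fun u => h (alpha u)).
Proof. by move=> Ah c u v; rewrite alpha_lin Ah. Qed.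

Lemma at_points_iter_alpha h A t q : weight_hom iota A h ->
  at_points f (fun u => h (iter q alpha u)) t = at_points f h (fun i => twist q (t i)).
Proof.
elim: q => [|q IH] in h *.
  by move=> Ah; apply: eq_at_points => // i _; case: (t i).
move=> Ah; rewrite (IH (fun u => h (alpha u)) (weight_hom_alpha Ah)).
exact: at_points_alpha Ah.
Qed.

(** Conformal sesquilinearity in a form that is the same for every slot: d acts on slot i as minus
    its parameter. In the last slot the factor d + l_1 + ... + l_p becomes [- A], since d is minus
    the total weight. A cochain with one free slot is thus a test map for another cochain. *)
Lemma at_points_slot h t (i : nat) A : (i <= p)%N ->
  weight_hom iota (weight p.+1 (seq_set t i (A, 0))) h ->
  weight_hom iota A (fun u => at_points f h (seq_set t i (A, u))).
Proof.
move=> le_ip th.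
pose E := fun j : 'I_p => (seq_set t i (A, 0) j).1.
pose x := [ffun j : 'I_p.+1 => (t j).2]; pose o : 'I_p.+1 := inord i.
have oE : o = i :> nat by rewrite inordK.
have slotE u : at_points f h (seq_set t i (A, u)) = vext E h (f (upd x o u)).
  rewrite /at_points; have -> : [ffun j : 'I_p.+1 => (seq_set t i (A, u) j).2] = upd x o u.
    by apply/ffunP => j; rewrite !ffunE /seq_set -val_eqE /= oE; case: eqP.
  by apply: eq_vext => // j; rewrite /E /seq_set; case: eqP.
have hD := weight_homD th.
apply: weight_hom_scale_add => [c u v|u]; rewrite !slotE.
  rewrite (cochain_lin fC) (vextD E _ _ hD).
  by rewrite (vext_scale _ _ _ th) evC evpC.
have updE v : upd x o v = upd (upd x o u) o v.
  by apply/ffunP => j; rewrite !ffunE; case: eqP.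
have uE : upd x o u o = u by rewrite ffunE eqxx.
rewrite updE -{2}uE; case: (unliftP ord_max o) => [j oj|oj].
  rewrite oj (cochain_partial fC) (vext_scale _ _ _ th) rmorphN evX /E /seq_set.
  have -> : (val j == i) by rewrite -oE oj /= /bump leqNgt ltn_ord.
  by [].
rewrite oj (cochain_partial_last fC) (vext_scale _ _ _ th); congr (_ *: _).
rewrite rmorphD evC evpX rmorph_sum (eq_bigr E) => [|j _]; last exact: evX.
have ip : i = p by rewrite -oE oj.
by rewrite /weight big_ord_recr /= opprD addrAC addNr add0r /seq_set -ip eqxx.
Qed.

End Cochain.
End Points.

Section LambdaPoints.
Variables (F : fieldType) (L : lmodType {poly F}).

(** The generic points: a cochain is recovered from its value there ([at_points_lam]), so identities
    between values yield identities between cochains. *)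
Definition lam_points r (x : {ffun 'I_r.+1 -> L}) (i : nat) : mpoly r {poly F} * L :=
  (lam (inord i), x (inord i)).

Lemma inord_lift p (i : 'I_p) : inord i = lift ord_max i :> 'I_p.+1.
Proof. by apply: val_inj; rewrite /= /bump leqNgt ltn_ord inordK // ltnS ltnW. Qed.

Lemma weight_lam_points r (x : {ffun 'I_r.+1 -> L}) : weight r.+1 (lam_points x) = - 'X%:MP.
Proof.
rewrite /weight big_ord_recr /= -[X in inord X]/(val (@ord_max r)) inord_val lam_max.
rewrite (eq_bigr (fun i : 'I_r => 'X_i)) => [|i _]; first exact: addNKr.
by rewrite inord_lift lam_lift.
Qed.

Lemma at_points_lam p (f : precochain L p) x :
  at_points (K := mpoly p {poly F}) (W := vpoly L p) f (@value F L p) (lam_points x) = f x.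
Proof.
rewrite /at_points.
have -> : [ffun i : 'I_p.+1 => (lam_points x i).2] = x.
  by apply/ffunP => i; rewrite ffunE /= inord_val.
transitivity (vsubst (fun i => 'X_i) (f x)); last exact: vsubst_id.
apply: eq_bigr => m _; congr (_ *: _); apply: eq_bigr => i _; congr (_ ^+ _).
by rewrite /= inord_lift lam_lift.
Qed.

End LambdaPoints.

(** * Composition of cochains *)

Section Composition.
Variables (F : fieldType) (L : lmodType {poly F}) (alpha : L -> L).
Hypothesis alpha_lin : forall p u v, alpha (p *: u + v) = p *: alpha u + alpha v.

Section Values.
Variables (K : comNzRingType) (iota : {rmorphism F -> K}) (W : lmodType K).
Local Notation point := (K * L)%type.
Implicit Types (A : K) (h : L -> W) (t : nat -> point).

Lemma at_points_sum p (f : precochain L p) (I : finType) (S : pred I) (c : I -> K)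
    (h : I -> L -> W) t :
  at_points f (fun u => \sum_(i | S i) c i *: h i u) t =
  \sum_(i | S i) c i *: at_points f (h i) t.
Proof. exact: vext_sum. Qed.

Lemma at_points_lin p (f : precochain L p) c (h1 h2 : L -> W) t :
  at_points f (fun u => c *: h1 u + h2 u) t = c *: at_points f h1 t + at_points f h2 t.
Proof.
pose hh (b : bool) := if b then h1 else h2; pose cc (b : bool) := if b then c else 1.
transitivity (\sum_(b : bool) cc b *: at_points f (hh b) t).
  rewrite -at_points_sum; apply: eq_at_points => // u.
  by rewrite big_bool /= scale1r.
by rewrite big_bool /= scale1r.
Qed.

Lemma at_points_scale p (f : precochain L p) c h t :
  at_points f (fun u => c *: h u) t = c *: at_points f h t.
Proof.
rewrite /at_points /vext scaler_sumr; apply: eq_bigr => m _.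
by rewrite !scalerA mulrC.
Qed.

Lemma at_pointsMn p (f : precochain L p) n h t :
  at_points f (fun u => h u *+ n) t = at_points f h t *+ n.
Proof.
by rewrite -scaler_nat -at_points_scale; apply: eq_at_points => // u; rewrite scaler_nat.
Qed.

Lemma at_points_swap p q (f : precochain L p) (g : precochain L q) (H : L -> L -> W) t s :
  at_points f (fun u => at_points g (H u) s) t = at_points g (fun v => at_points f (H^~ v) t) s.
Proof. exact: vext_swap. Qed.

Lemma weight_cns n (a : point) t : weight n.+1 (seq_cons a t) = a.1 + weight n t.
Proof. by rewrite /weight big_ord_recl. Qed.

Lemma weight_add m n t : weight (m + n) t = weight m t + weight n (fun j => t (m + j)%N).
Proof. by rewrite /weight big_split_ord. Qed.

Lemma weight_hom_at_points p (f : precochain L p) h A t : is_cochain alpha f ->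
  weight_hom iota (A + weight p t) h -> weight_hom iota A (fun u => at_points f h (seq_cons (A,
    u) t)).
Proof.
move=> fC Ah; have E u : seq_set (seq_cons (A, 0) t) 0 (A, u) = seq_cons (A, u) t.
  by apply: functional_extensionality => -[].
have := @at_points_slot _ _ _ iota _ alpha p f fC h (seq_cons (A, 0) t) 0 A (leq0n p).
rewrite E weight_cns => /(_ Ah) H c u v; have := H c u v; by rewrite !E.
Qed.

(** f(g(t_0, ..., t_q), alpha^q t_(q+1), ...): the summand of [circ] for the identity shuffle. The
    value of [g] carries the sum of the parameters of [g]. *)
Definition comp p q (f : precochain L p) (g : precochain L q) h t : W :=
  at_points g (fun u =>
    at_points f h (seq_cons (weight q.+1 t, u) (fun j => twist alpha q (t (q.+1 + j)%N)))) t.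

Lemma eq_comp p q (f : precochain L p) (g : precochain L q) h h' t t' :
  h =1 h' -> (forall i, (i <= p + q)%N -> t i = t' i) ->
  comp f g h t = comp f g h' t'.
Proof.
move=> hh' tt'; apply: eq_at_points => [u|i le_iq]; last by apply: tt'; lia.
apply: eq_at_points => // -[_|i lt_ip] /=; last by rewrite tt' //; lia.
by congr (_, _); apply: eq_wt => j lt_jq; rewrite tt' //; lia.
Qed.

Section Perm.
Variables (p q : nat) (f : precochain L p) (g : precochain L q).
Hypotheses (fC : is_cochain alpha f) (gC : is_cochain alpha g).

Lemma weight_hom_comp h t : weight_hom iota (weight (p + q).+1 t) h ->
  weight_hom iota (weight q.+1 t) (fun u =>
    at_points f h (seq_cons (weight q.+1 t, u) (fun j => twist alpha q (t (q.+1 + j)%N)))).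
Proof.
move=> th; apply: weight_hom_at_points => //.
by move: th; rewrite addnC -addSn weight_add.
Qed.

Lemma comp_perm_left h t b phi : weight_hom iota (weight (p + q).+1 t) h ->
  nat_perm q.+1 b phi ->
  comp f g h (fun i => t (phi i)) = (-1) ^+ b *: comp f g h t.
Proof.
move=> th bphi; rewrite -(at_points_nat_perm gC (weight_hom_comp th) bphi).
apply: eq_at_points => // u; apply: eq_at_points => // -[_|i _] /=.
  by rewrite (weight_nat_perm _ bphi).
by have [tau _ ->] := bphi; rewrite perm_nat_out // leq_addr.
Qed.

Lemma comp_perm_right h t b phi : weight_hom iota (weight (p + q).+1 t) h ->
  nat_perm p b phi ->
  comp f g h (fun i => t (offset q.+1 phi i)) = (-1) ^+ b *: comp f g h t.
Proof.
move=> th bphi; rewrite /comp.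
have offsetE i : (i < q.+1)%N -> offset q.+1 phi i = i by rewrite /offset => ->.
rewrite -at_points_scale; apply: eq_at_points => [u|i le_iq]; last by rewrite offsetE.
have bphi' : nat_perm p.+1 b (offset 1 phi) by exact: nat_perm_offset bphi.
rewrite -(at_points_nat_perm (iota := iota) fC _ bphi'); last first.
  by rewrite weight_cns /=; move: th; rewrite addnC -addSn weight_add.
apply: eq_at_points => // -[_|i _] /=.
  by congr (_, _); apply: eq_wt => i lt_iq; rewrite offsetE.
by rewrite subSS subn0 {1}/offset ltnNge leq_addr addKn.
Qed.

Lemma comp_swap h t i j : weight_hom iota (weight (p + q).+1 t) h ->
  (i < (p + q).+1)%N -> (j < (p + q).+1)%N -> i != j -> (i <= q)%N = (j <= q)%N ->
  comp f g h (fun k => t (swap i j k)) = - comp f g h t.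
Proof.
move=> th lt_i lt_j ij; case: (leqP i q) => [le_iq /esym le_jq|lt_qi /esym/negbT].
  by rewrite (comp_perm_left th (nat_perm_swap _ _ ij)) // scaleN1r.
rewrite -ltnNge => lt_qj.
rewrite -scaleN1r -(comp_perm_right (b := true) th (phi := swap (i - q.+1) (j - q.+1))).
  apply: eq_comp => // k _; congr t; rewrite /offset /swap.
  by do ?[case: eqP => ?]; case: ltnP => ?; lia.
by apply: nat_perm_swap; lia.
Qed.

End Perm.

(** A transposition inside a block changes the sign of [comp] and that of the permutation, so the
    signed summand is invariant and [sum_shuffle] applies. *)
Lemma at_points_alt_comp p q r (f : precochain L p) (g : precochain L q) h t :
    is_cochain alpha f -> is_cochain alpha g -> r = (p + q)%N ->
    weight_hom iota (weight r.+1 t) h ->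
  (\sum_(tau : 'S_r.+1 | shuffle q tau)
    (-1) ^+ odd_perm tau *: comp f g h (fun i => t (perm_nat tau i))) *+ (q.+1`! * p`!) =
  alt r.+1 (comp f g h) t.
Proof.
move=> fC gC rE th; have le_qr : (q <= r)%N by lia.
have -> : p`! = (r - q)`! by congr _`!; lia.
rewrite -(sum_shuffle le_qr) // => i j sigma ij.
case: (eqVneq i j) => [->|neq_ij]; first by rewrite tperm1 mul1g.
rewrite odd_mul_tperm neq_ij signr_addb expr1 mulN1r scaleNr -scalerN; congr (_ *: _).
rewrite -[RHS]opprK; congr (- _); rewrite -(comp_swap fC gC (i := i) (j := j)) -?rE ?weight_perm //.
by apply: eq_comp => // k _; rewrite perm_natM perm_nat_tperm.
Qed.

End Values.

Lemma vext_at_points (K : comNzRingType) (iota : {rmorphism F -> K}) (W : lmodType K)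
    k p (f : precochain L p) (E : 'I_k -> K) A (h : L -> W) (g : L -> vpoly L k) t :
  weight_hom iota A h -> vext E h (at_points (K := mpoly k {poly F}) (W := vpoly L k) f g t) =
  at_points f (fun u => vext E h (g u)) (fun i => (ev iota E A (t i).1, (t i).2)).
Proof. exact: vext_vext. Qed.

Lemma vextend_vext k r (E E' : 'I_k -> mpoly r {poly F}) (h h' : L -> vpoly L r) P :
  E =1 E' -> h =1 h' ->
  vextend E h P = vext (K := mpoly r {poly F}) (W := vpoly L r) E' h' P.
Proof. exact: (@eq_vext F L (mpoly r {poly F}) (vpoly L r)). Qed.

Lemma circ_comp p q r (f : precochain L p) (g : precochain L q) x : r = (p + q)%N ->
  circ alpha f g x = \sum_(tau : 'S_r.+1 | shuffle q tau) (-1) ^+ odd_perm tau *: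
    comp (K := mpoly r {poly F}) (W := vpoly L r) f g (@value F L r)
      (fun i => lam_points x (perm_nat tau i)).
Proof.
move=> rE; apply: eq_bigr => tau _; apply: (congr1 ( *:%R _)).
have ptE i : (i <= r)%N -> lam_points x (perm_nat tau i) = (lam (tau (inord i)), x (tau (inord i))).
  by move=> le_ir; rewrite perm_nat_inord // /lam_points inord_val.
rewrite /comp /at_points.
have -> : [ffun i : 'I_q.+1 => x (tau (inord i))] =
    [ffun i : 'I_q.+1 => (lam_points x (perm_nat tau i)).2].
  by apply/ffunP => i; rewrite !ffunE ptE //; have := ltn_ord i; lia.
apply: vextend_vext => [i|u]; first by rewrite ptE //; have := ltn_ord i; lia.
set y := [ffun j : 'I_p.+1 => _]; set z := [ffun j : 'I_p.+1 => _].
have -> : y = z.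
  apply/ffunP => -[[|j] lt_jp]; rewrite !ffunE //.
  rewrite -[RHS]/(iter q alpha (lam_points x (perm_nat tau (q.+1 + j)%N)).2).
  by rewrite ptE ?addSnnS //; lia.
apply: vextend_vext => // -[[|j] lt_jp] /=.
  apply: eq_bigr => i _; rewrite -[RHS]/(lam_points x (perm_nat tau i)).1 ptE //.
  by have := ltn_ord i; lia.
by rewrite -[RHS]/(lam_points x (perm_nat tau (q.+1 + j)%N)).1 ptE ?addSnnS //; lia.
Qed.

Section Circ.
Variables (K : comNzRingType) (iota : {rmorphism F -> K}) (W : lmodType K).
Variables (p q r : nat) (f : precochain L p) (g : precochain L q).
Hypothesis rE : r = (p + q)%N.

(** [circ] is a sum of [comp] at the generic points, and evaluation specializes those to [t]. *)
Lemma at_points_circ (h : L -> W) t : weight_hom iota (weight r.+1 t) h ->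
  at_points (circ alpha f g : precochain L r) h t = \sum_(tau : 'S_r.+1 | shuffle q tau)
    (-1) ^+ odd_perm tau *: comp f g h (fun i => t (perm_nat tau i)).
Proof.
move=> th; rewrite /at_points (circ_comp _ _ _ rE) (vext_sumr _ _ _ _ _ th).
apply: eq_bigr => tau _; rewrite rmorph_sign; congr (_ *: _).
pose x := [ffun i : 'I_r.+1 => (t i).2].
have ptE i : (i <= r)%N ->
    (ev iota (fun i : 'I_r => (t i).1) (weight r.+1 t) (lam_points x (perm_nat tau i)).1,
     (lam_points x (perm_nat tau i)).2) = t (perm_nat tau i).
  move=> le_ir; have lt_ir : (perm_nat tau i < r.+1)%N by rewrite perm_nat_lt.
  by rewrite /lam_points ev_lam ffunE inordK //; case: (t _).
rewrite /comp (vext_at_points _ _ _ _ th); apply: eq_at_points => [u|i le_iq]; last first.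
  by rewrite ptE //; lia.
rewrite (vext_at_points _ _ _ _ th); apply: eq_at_points => [v|[_|i lt_ip]] /=.
- exact: vext_value th.
- rewrite rmorph_sum; congr (_, _); apply: eq_bigr => i _.
  by have := ptE i; rewrite /= => <- //; have := ltn_ord i; lia.
- by rewrite /twist /=; have := ptE (q.+1 + i)%N; rewrite /= => <- //; lia.
Qed.

Lemma at_points_circ_alt (h : L -> W) t :
    is_cochain alpha f -> is_cochain alpha g -> weight_hom iota (weight r.+1 t) h ->
  at_points (circ alpha f g : precochain L r) h t *+ (q.+1`! * p`!) =
  alt r.+1 (comp f g h) t.
Proof. by move=> fC gC th; rewrite at_points_circ // (at_points_alt_comp fC gC rE th). Qed.

End Circ.
End Composition.

(** * Closure of cochains under composition *)

Section CircCochain.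
Variables (F : fieldType) (L : lmodType {poly F}) (alpha : L -> L).
Hypothesis alpha_lin : forall p u v, alpha (p *: u + v) = p *: alpha u + alpha v.
Hypothesis char0 : forall n, n.+1%:R != 0 :> F.

Lemma iter_alpha_lin q p u v :
  iter q alpha (p *: u + v) = p *: iter q alpha u + iter q alpha v.
Proof. by elim: q => //= q ->; rewrite alpha_lin. Qed.

Section Values.
Variables (K : comNzRingType) (iota : {rmorphism F -> K}) (W : lmodType K).
Local Notation point := (K * L)%type.
Implicit Types (A : K) (h : L -> W) (t : nat -> point).

(** Positive integers are invertible in [F], hence act injectively on any [K]-module through [iota];
    this cancels the factorials. *)
Lemma mulrn_inj n (v w : W) : (0 < n)%N -> v *+ n = w *+ n -> v = w.
Proof.
case: n => // n _ /(congr1 (GRing.scale (iota n.+1%:R^-1))).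
rewrite -!scaler_nat !scalerA -(rmorph_nat iota) -rmorphM mulVf ?char0 // rmorph1.
by rewrite !scale1r.
Qed.

Lemma weight_hom_sum (I : finType) (S : pred I) A (c : I -> K) (h : I -> L -> W) :
  (forall i, S i -> weight_hom iota A (h i)) ->
  weight_hom iota A (fun u => \sum_(i | S i) c i *: h i u).
Proof.
move=> Ah p u v; rewrite scaler_sumr -big_split; apply: eq_bigr => i Si /=.
by rewrite Ah // scalerDr !scalerA mulrC.
Qed.

Section Comp.
Variables (p q : nat) (f : precochain L p) (g : precochain L q).
Hypotheses (fC : is_cochain alpha f) (gC : is_cochain alpha g).

(** For i <= q the free slot lies in [g], and the outer map stays fixed because it sees the slot
    only through its parameter. For i > q the slot lies in [f] behind alpha^q, which commutes with
    the action of polynomials in d. *)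
Lemma comp_slot h t i A : (i <= p + q)%N ->
  weight_hom iota (weight (p + q).+1 (seq_set t i (A, 0))) h ->
  weight_hom iota A (fun u => comp alpha f g h (seq_set t i (A, u))).
Proof.
move=> le_i th; have wtE n u : weight n (seq_set t i (A, u)) = weight n (seq_set t i (A, 0)).
  by apply: eq_wt => j _; rewrite /seq_set; case: eqP.
case: (leqP i q) => [le_iq|lt_qi].
  set t0 := seq_set t i (A, 0).
  pose G v := at_points f h (seq_cons (weight q.+1 t0, v) (fun j =>
    twist alpha q (t (q.+1 + j)%N))).
  have GE u v : at_points f h (seq_cons (weight q.+1 (seq_set t i (A, u)), v)
      (fun j => twist alpha q (seq_set t i (A, u) (q.+1 + j)%N))) = G v.
    rewrite wtE; congr (at_points f h (seq_cons _ _)); apply: functional_extensionality => j.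
    by rewrite /seq_set ifN //; lia.
  have Gt0 : weight_hom iota (weight q.+1 t0) G.
    move=> c u v; rewrite -!(GE 0); exact: (weight_hom_comp fC th).
  move=> c u v; have := at_points_slot gC le_iq Gt0 c u v.
  rewrite /comp !(fun w => eq_at_points g (GE w) (fun _ _ => erefl)).
  by [].
move=> c u v; have neq_i j : (j <= q)%N -> (j == i) = false by lia.
set w := weight q.+1 t.
pose s := fun j => twist alpha q (t (q.+1 + j)%N); pose k := (i - q.+1)%N.
pose H u v := at_points f h (seq_set (seq_cons (w, v) s) k.+1 (A, iter q alpha u)).
have compE u' : comp alpha f g h (seq_set t i (A, u')) = at_points g (H u') t.
  apply: eq_at_points => [v'|j le_jq]; last by rewrite /seq_set neq_i.
  apply: eq_at_points => // -[_|j _].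
    by congr (_, _); apply: eq_wt => j lt_jq; rewrite /seq_set neq_i.
  rewrite /seq_set /=.
  have -> : (j.+1 == k.+1)%N = (q.+1 + j == i)%N by rewrite /k; lia.
  by case: eqP.
rewrite !compE -at_points_lin; apply: eq_at_points => // v'; rewrite /H iter_alpha_lin.
have le_kp : (k.+1 <= p)%N by rewrite /k; lia.
apply: (at_points_slot fC le_kp (t := seq_cons (w, v') s)).
have -> : weight p.+1 (seq_set (seq_cons (w, v') s) k.+1 (A, 0)) =
  weight (p + q).+1 (seq_set t i (A, 0)).
  rewrite [in RHS]addnC -addSn weight_add /weight big_ord_recl /=; congr (_ + _).
    by apply: eq_bigr => j _; rewrite /seq_set neq_i // -ltnS.
  apply: eq_bigr => j _; rewrite /seq_set /= add0n.
  have -> : (bump 0 j == k.+1) = (q.+1 + j == i)%N by rewrite /bump /k; lia.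
  by case: eqP.
exact: th.
Qed.

Lemma comp_alpha h t : weight_hom iota (weight (p + q).+1 t) h ->
  comp alpha f g (fun u => h (alpha u)) t = comp alpha f g h (fun i => twist alpha 1 (t i)).
Proof.
move=> th; set t' := fun i => twist alpha 1 (t i).
have weight' n : weight n t' = weight n t by apply: eq_wt.
pose H v := at_points f h (seq_cons (weight q.+1 t', v) (fun j => twist alpha q (t' (q.+1 + j)%N))).
have t'H : weight_hom iota (weight q.+1 t') H by apply: (weight_hom_comp fC); rewrite weight'.
rewrite -[RHS](at_points_alpha alpha_lin gC _ t'H); apply: eq_at_points => // u.
rewrite (at_points_alpha alpha_lin fC _ th); apply: eq_at_points => // -[_|j _] /=.
  by rewrite weight'.
by rewrite /twist /= -iterS iterSr.
Qed.

End Comp.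

Section Circ.
Variables (p q r : nat) (f : precochain L p) (g : precochain L q).
Hypotheses (fC : is_cochain alpha f) (gC : is_cochain alpha g) (rE : r = (p + q)%N).

(** Multiplied by (q+1)! p!, the shuffle sum is a full alternating sum, for which the claim is a
    reindexing. *)
Lemma at_points_circ_perm h t (tau : 'S_r.+1) : weight_hom iota (weight r.+1 t) h ->
  at_points (circ alpha f g : precochain L r) h (fun i => t (perm_nat tau i)) =
  (-1) ^+ odd_perm tau *: at_points (circ alpha f g : precochain L r) h t.
Proof.
move=> th; apply: (@mulrn_inj (q.+1`! * p`!)); first by rewrite muln_gt0 !fact_gt0.
have altE s : weight_hom iota (weight r.+1 s) h -> _ := at_points_circ_alt rE fC gC (t := s).
apply: etrans (altE _ _) _; first by rewrite weight_perm.
rewrite scalerMnr; apply: etrans _ (congr1 ( *:%R _) (esym (altE _ th))).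
by apply: (alt_arg_nat_perm (phi := perm_nat tau)); exists tau.
Qed.

Lemma at_points_circ_alpha h t : weight_hom iota (weight r.+1 t) h ->
  at_points (circ alpha f g : precochain L r) (fun u => h (alpha u)) t =
  at_points (circ alpha f g : precochain L r) h (fun i => twist alpha 1 (t i)).
Proof.
move=> th; apply: etrans (at_points_circ alpha f g rE (weight_hom_alpha alpha_lin th)) _.
have th' : weight_hom iota (weight r.+1 (fun i => twist alpha 1 (t i))) h
  by rewrite (eq_wt (t' := t)).
apply: etrans _ (esym (at_points_circ alpha f g rE th')).
apply: eq_bigr => tau _; congr (_ *: _); apply: (comp_alpha fC gC (t := fun i =>
  t (perm_nat tau i))).
by rewrite -rE weight_perm.
Qed.

End Circ.
End Values.

Section Cochain.
Variables (r : nat) (f : precochain L r).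
Local Notation K := (mpoly r {poly F}).
Local Notation W := (vpoly L r).

(* It is enough to test the axioms of a cochain on its values at the points
   [lam_points x]. *)
Lemma cochain_lam_points :
    (forall x i, weight_hom (scal F r : {rmorphism F -> K}) (lam i : K) (fun u =>
      f (upd x i u) : W)) ->
    (forall x, at_points (K := K) (W := W) f (fun u => value r (alpha u)) (lam_points x) =
      at_points (K := K) (W := W) f (@value F L r) (fun i => twist alpha 1 (lam_points x i))) ->
    (forall (tau : 'S_r.+1) x,
      at_points (K := K) (W := W) f (@value F L r) (fun i => lam_points x (perm_nat tau i)) =
      (-1) ^+ odd_perm tau *:
        at_points (K := K) (W := W) f (@value F L r) (lam_points x)) ->
  is_cochain alpha f.
Proof.
move=> slot alphaE permE.
have partialE x i : f (upd x i ('X *: x i)) = - lam i *: f x.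
  have := weight_homZ (slot x i) 'X (x i); rewrite evpX => ->; apply: (congr1 ( *:%R _)).
  by congr f; apply/ffunP => j; rewrite ffunE; case: eqP => [->|].
split=> [x i c u v|x|x i|x|tau x].
- by have := slot x i c%:P u v; rewrite evpC.
- have -> : vmap alpha (f x) =
      at_points (K := K) (W := W) f (fun u => value r (alpha u)) (lam_points x).
    rewrite /at_points.
    have -> : [ffun i : 'I_r.+1 => (lam_points x i).2] = x.
      by apply/ffunP => i; rewrite ffunE /= inord_val.
    have -> : (fun i : 'I_r => (lam_points x i).1) = (fun i => 'X_i).
      by apply: functional_extensionality => i; rewrite /= inord_lift lam_lift.
    apply: etrans (esym (vsubst_id _)) _.
    apply: (vext_vmap (K := K) (W := W) _ _ (@weight_hom_value F L r)).
      by rewrite -[X in alpha X](addr0 0) -{1}(scaler0 _ (-1)) alpha_lin scaleN1r addNr.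
    by move=> u v; have := alpha_lin 1 u v; rewrite !scale1r.
  rewrite alphaE; apply: etrans _ (at_points_lam _ _).
  by apply: eq_at_points => // i _; rewrite /lam_points /twist ffunE.
- by rewrite partialE lam_lift.
- rewrite partialE lam_max; apply: (congr1 ( *:%R^~ _)).
  by rewrite opprB opprK.
- have := permE tau x; rewrite at_points_lam => E.
  apply: etrans (esym (signZK (odd_perm tau) (f x))) _; apply: (congr1 ( *:%R _)).
  apply: etrans (esym E) _; rewrite /at_points.
  have -> : [ffun i : 'I_r.+1 => (lam_points x (perm_nat tau i)).2] = [ffun i => x (tau i)].
    by apply/ffunP => i; rewrite !ffunE perm_nat_ord /= inord_val.
  have -> : (fun i : 'I_r => (lam_points x (perm_nat tau i)).1) =
      (fun i => lam (tau (lift ord_max i))).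
    apply: functional_extensionality => i.
    by rewrite /= perm_nat_inord ?inord_val ?inord_lift // ltnS ltnW.
  by [].
Qed.

End Cochain.

Lemma circ_cochain p q r (f : precochain L p) (g : precochain L q) : r = (p + q)%N ->
  is_cochain alpha f -> is_cochain alpha g ->
  is_cochain alpha (circ alpha f g : precochain L r).
Proof.
move=> rE fC gC.
have th (x : {ffun 'I_r.+1 -> L}) : weight_hom (scal F r) (weight r.+1 (lam_points x)) (@value F
  L r).
  by rewrite weight_lam_points; exact: weight_hom_value.
apply: cochain_lam_points => [x i|x|tau x].
(* In the summand of [tau], argument i of [x] is read at position [tau^-1 i]. *)
- have E u : circ alpha f g (upd x i u) = \sum_(tau : 'S_r.+1 | shuffle q tau)
      (-1) ^+ odd_perm tau *: comp alpha (K := mpoly r {poly F}) (W := vpoly L r) f g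
        (@value F L r) (seq_set (fun j => lam_points x (perm_nat tau j)) (tau^-1 i)%g (lam i, u)).
    apply: etrans (circ_comp alpha f g _ rE) _; apply: eq_bigr => tau _.
    apply: (congr1 ( *:%R _)).
    apply: (@eq_comp F L alpha (mpoly r {poly F}) (vpoly L r)) => // j le_jr.
    rewrite /seq_set /lam_points perm_nat_inord ?inord_val; last by lia.
    have -> : (j == (tau^-1 i)%g) = (tau (inord j) == i).
      rewrite -(inj_eq (@perm_inj _ tau^-1%g)) permK -val_eqE /= inordK //; lia.
    by rewrite ffunE; case: eqP => // ->.
  rewrite (functional_extensionality _ _ E).
  apply: (@weight_hom_sum (mpoly r {poly F}) (scal F r) (vpoly L r)) => tau _.
  have le_i : ((tau^-1 i)%g <= p + q)%N by rewrite -rE -ltnS ltn_ord.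
  apply: comp_slot => //; rewrite -rE.
  have -> : weight r.+1 (seq_set (fun j => lam_points x (perm_nat tau j)) (tau^-1 i)%g (lam i, 0)) =
      weight r.+1 (lam_points x).
    rewrite -[RHS](weight_perm tau); apply: eq_wt => j lt_jr; rewrite /seq_set.
    case: eqP => // ->; rewrite perm_nat_ord permKV /lam_points /= inord_val.
    by [].
  exact: th.
- exact (@at_points_circ_alpha (mpoly r {poly F}) (scal F r) (vpoly L r) p q r f g fC gC rE
  (@value F L r) (lam_points x) (th x)).
- exact (@at_points_circ_perm (mpoly r {poly F}) (scal F r) (vpoly L r) p q r f g fC gC rE
  (@value F L r) (lam_points x) tau (th x)).
Qed.

End CircCochain.

(** * The graded pre-Lie identity *)

(** Multiplication by [tperm ord0 k] gives a bijection with the permutations fixing [ord0]. *)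
Lemma card_perm_fiber n (k : 'I_n.+1) : #|[pred rho : 'S_n.+1 | (rho^-1)%g ord0 == k]| = n`!.
Proof.
have <- : #|perm_on [set~ ord0 : 'I_n.+1]| = n`! by rewrite card_perm cardsC1 card_ord.
rewrite -(card_imset _ (mulgI (tperm ord0 k))); apply: eq_card => sigma.
have fixP : (sigma \in perm_on [set~ ord0]) = (sigma ord0 == ord0).
  apply/idP/eqP => [s0|s0]; first by rewrite (out_perm s0) // !inE eqxx.
  by apply/subsetP => i; rewrite !inE; apply: contraNneq => ->; rewrite s0.
rewrite fixP; apply/imsetP/eqP => [[rho /eqP rhok ->]|s0].
  by rewrite permM tpermL -rhok permKV.
exists (tperm ord0 k * sigma)%g; last by rewrite mulgA tperm2 mul1g.
rewrite inE; apply/eqP/(@perm_inj _ (tperm ord0 k * sigma)%g).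
by rewrite permKV permM tpermR.
Qed.

(** Meant for a composition of [f] and [g] in which point 0 is the value of a third cochain:
    [rho^-1 0 <= q] says that this value is fed to [g], otherwise it is fed directly to [f]. *)
Lemma sum_perm_preimage n q (V : zmodType) (G : 'S_n.+1 -> V) (a b : V) : (q <= n)%N ->
    (forall rho : 'S_n.+1, ((rho^-1)%g ord0 <= q)%N -> G rho = a) ->
    (forall rho : 'S_n.+1, (q < (rho^-1)%g ord0)%N -> G rho = b) ->
  \sum_rho G rho = (a *+ q.+1 + b *+ (n - q)) *+ n`!.
Proof.
move=> le_qn Ga Gb.
rewrite (partition_big (fun rho : 'S_n.+1 => (rho^-1)%g ord0) predT) //=.
transitivity (\sum_(k < n.+1) (if (k < q.+1)%N then a else b) *+ n`!).
  apply: eq_bigr => k _; rewrite -(card_perm_fiber k) -sumr_const.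
  apply: eq_bigr => rho /eqP rhok; rewrite ltnS; case: leqP => le_k.
    by rewrite Ga // rhok.
  by rewrite Gb // rhok.
rewrite sumrMnl; congr (_ *+ _).
suff sumE d : \sum_(k < (q + d).+1) (if (k < q.+1)%N then a else b) = a *+ q.+1 + b *+ d.
  by have := sumE (n - q)%N; rewrite subnKC.
rewrite -addSn big_split_ord /=; congr (_ + _).
  by rewrite (eq_bigr (fun=> a)) ?sumr_const ?card_ord // => i _; rewrite ltn_ord.
rewrite (eq_bigr (fun=> b)) ?sumr_const ?card_ord // => i _.
by rewrite ltnNge leq_addr.
Qed.

Section PreLie.
Variables (F : fieldType) (L : lmodType {poly F}) (alpha : L -> L).
Hypothesis alpha_lin : forall p u v, alpha (p *: u + v) = p *: alpha u + alpha v.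
Hypothesis char0 : forall n, n.+1%:R != 0 :> F.
Variables (K : comNzRingType) (iota : {rmorphism F -> K}) (W : lmodType K).
Local Notation point := (K * L)%type.
Local Notation pt := (@twist F L K alpha).
Implicit Types (h : L -> W) (t s : nat -> point).

Lemma twistD q k (a : point) : pt q (pt k a) = pt (q + k) a.
Proof. by rewrite /twist /= iterD. Qed.

Section Three.
Variables (p q k : nat).
Variables (f : precochain L p) (g : precochain L q) (e : precochain L k).
Hypotheses (fC : is_cochain alpha f) (gC : is_cochain alpha g) (eC : is_cochain alpha e).
Variable h : L -> W.

(* f(g(e(t_0, ..., t_k), ...), ...) *)
Definition comp3 t : W :=
  comp alpha g e (fun v =>
    at_points f h (seq_cons (weight (q + k).+1 t, v) (fun j =>
      pt (q + k) (t ((q + k).+1 + j)%N)))) t.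

(* f(g(t_(k+1), ..., t_(k+q+1)), e(t_0, ..., t_k), ...), where [g] and [e] are
   applied in parallel. *)
Definition comp_par t : W :=
  at_points e (fun u => at_points g (fun v =>
    at_points f h (seq_cons (weight q.+1 (fun i => t (k.+1 + i)%N), v)
                  (seq_cons (weight k.+1 t, iter q alpha u)
                       (fun j => pt (q + k) (t (k.+1 + (q.+1 + j))%N)))))
    (fun i => pt k (t (k.+1 + i)%N))) t.

Variable N : nat.
Hypothesis NE : N = (p + q + k)%N.

(** Scaled by its factorial factor, the inner [circ] is an alternating sum over (m+1)! permutations;
    the outer alternation absorbs each with its sign. *)
Lemma alt_comp_circr m t : m = (q + k)%N -> weight_hom iota (weight N.+1 t) h ->
  alt N.+1 (comp alpha f (circ alpha g e : precochain L m) h) t *+ (k.+1`! * q`!) =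
  alt N.+1 comp3 t *+ m.+1`!.
Proof.
move=> mE th; rewrite -altMn.
transitivity (alt N.+1 (fun s => \sum_(rho : 'S_m.+1)
    (-1) ^+ odd_perm rho *: comp3 (fun i => s (perm_nat rho i))) t).
  apply: eq_alt => tau; set s := fun i => t (perm_nat tau i).
  have sh : weight_hom iota (weight N.+1 s) h by rewrite weight_perm.
  apply: etrans (at_points_circ_alt (iota := iota) mE gC eC _) _.
    apply: (weight_hom_at_points fC); move: sh; rewrite NE -addnA -mE addnC -addSn.
    by rewrite weight_add.
  apply: eq_bigr => rho _; congr (_ *: _); rewrite /comp3 -mE.
  apply: eq_comp => // v; apply: eq_at_points => // -[_|j _] /=.
    by rewrite -(weight_perm rho s).
  by rewrite (perm_nat_out rho) ?leq_addr.
rewrite alt_sum => [|rho b]; last exact: mulrC.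
rewrite -card_Sn -sumr_const; apply: eq_bigr => rho _.
have rhoN : nat_perm N.+1 (odd_perm rho) (perm_nat rho).
  have le_mN : (0 + m.+1 <= N.+1)%N by lia.
  apply: nat_perm_eq (nat_perm_offset le_mN (_ : nat_perm m.+1 rho (perm_nat rho))).
    by move=> i; rewrite /offset subn0.
  by exists rho.
by rewrite (alt_nat_perm comp3 t rhoN) signZK.
Qed.

Section Right.
Variables (n : nat) (t : nat -> point).
Hypotheses (nE : n = (p + q)%N) (th : weight_hom iota (weight N.+1 t) h).

(** Point 0 is the value of [e], the other points are the remaining arguments twisted by alpha^k;
    [rho] distributes them over [f] and [g]. *)
Let U (rho : 'S_n.+1) s : W := at_points e (fun u => comp alpha f g h (fun i =>
  seq_cons (weight k.+1 s, u) (fun j => pt k (s (k.+1 + j)%N)) (perm_nat rho i))) s.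

(** This depends only on whether point 0 is fed to [g]: [G_block] moves it within a block and
    [G_fix] rearranges all other points. The identity and a cycle of length q+2 represent the two
    cases. *)
Let G (rho : 'S_n.+1) : W := (-1) ^+ odd_perm rho *: alt N.+1 (U rho) t.

Let weight_inner s u : weight n.+1 (seq_cons (weight k.+1 s, u) (fun j =>
  pt k (s (k.+1 + j)%N))) = weight N.+1 s.
Proof. by rewrite weight_cns NE -nE addnC -addSn weight_add. Qed.

Let G_block (i j : 'I_n.+1) rho : (i <= q)%N = (j <= q)%N -> G (tperm i j * rho)%g = G rho.
Proof.
move=> ij; rewrite /G; case: (eqVneq i j) => [->|neq_ij]; first by rewrite tperm1 mul1g.
have -> : alt N.+1 (U (tperm i j * rho)%g) t =
    alt N.+1 (fun s => (-1) ^+ true *: U rho s) t.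
  apply: eq_alt => tau; set s := fun i => t (perm_nat tau i).
  have sh : weight_hom iota (weight N.+1 s) h by rewrite weight_perm.
  rewrite -at_points_scale; apply: eq_at_points => // u; rewrite scaleN1r.
  set c := seq_cons _ _; rewrite -(comp_swap (iota := iota) fC gC (t := fun x =>
    c (perm_nat rho x)) (i := i) (j := j)).
  - by apply: eq_comp => // x _; rewrite perm_natM perm_nat_tperm.
  - by rewrite -nE weight_perm weight_inner.
  - by rewrite -nE.
  - by rewrite -nE.
  - by [].
  - by [].
by rewrite alt_sign odd_mul_tperm neq_ij signr_addb mulrC -scalerA signZK.
Qed.

Let G_fix rho (sigma : 'S_n.+1) : sigma ord0 = ord0 -> G (rho * sigma)%g = G rho.
Proof.
move=> s0; rewrite /G.
have le_kN : (k + n.+1 <= N.+1)%N by lia.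
(* Point j+1 is built from s (k + (j+1)), so the shift is by k; index k, the last argument of [e],
   stays in place because [sigma] fixes 0. *)
have sN : nat_perm N.+1 sigma (offset k (perm_nat sigma)).
  by apply: nat_perm_offset le_kN _; exists sigma.
have p0 : perm_nat sigma 0 = 0%N by rewrite -[0%N in LHS]/(val (@ord0 n)) perm_nat_ord s0.
have fixE i : (i <= k)%N -> offset k (perm_nat sigma) i = i.
  rewrite /offset leq_eqVlt => /predU1P[->|->//].
  by rewrite ltnn subnn p0 addn0.
transitivity ((-1) ^+ odd_perm (rho * sigma)%g *:
    alt N.+1 (fun s => U rho (fun i => s (offset k (perm_nat sigma) i))) t).
  congr (_ *: _); suff UE s : U (rho * sigma)%g s =
      U rho (fun i => s (offset k (perm_nat sigma) i)) by apply: eq_alt => tau.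
  apply: eq_at_points => [u|i le_ik]; last by rewrite fixE.
  apply: eq_comp => // i _; rewrite perm_natM; case: (perm_nat rho i) => [|j]; first rewrite p0 /=.
    by congr (_, _); apply: eq_wt => i' lt_i'; rewrite fixE.
  case E: (perm_nat sigma j.+1) => [|j'] /=.
    have : perm_nat sigma^-1%g (perm_nat sigma j.+1) = perm_nat sigma^-1%g (perm_nat sigma 0)
      by rewrite E p0.
    by rewrite -!perm_natM mulgV !perm_nat1.
  by rewrite /offset [(k.+1 + j)%N]addSnnS ltnNge leq_addr addKn E addSnnS.
by rewrite (alt_nat_perm _ t sN) odd_permM signr_addb -!scalerA signZK.
Qed.

Let G_id : G 1%g = alt N.+1 comp3 t.
Proof.
rewrite /G odd_perm1 expr0 scale1r; suff UE s : U 1%g s = comp3 s by apply: eq_alt => tau.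
apply: eq_at_points => // u; rewrite /comp; apply: eq_at_points => [v|i _]; last first.
  by rewrite perm_nat1.
apply: eq_at_points => // -[_|j _] /=.
  congr (_, _); transitivity (weight q.+1 (seq_cons (weight k.+1 s, u) (fun j =>
    pt k (s (k.+1 + j)%N)))).
    by apply: eq_wt => i _; rewrite perm_nat1.
  by rewrite weight_cns addnC -addSn weight_add.
by rewrite perm_nat1 /= twistD; congr (pt _ (s _)); lia.
Qed.

Let G_cycle (gamma : 'S_n.+1) : odd_perm gamma = odd q.+1 ->
  (forall i, perm_nat gamma i =
     if (i < q.+1)%N then i.+1 else if i == q.+1 then 0%N else i) ->
  G gamma = (-1) ^+ q.+1 *: alt N.+1 comp_par t.
Proof.
move=> og gE; rewrite /G og signr_odd; congr (_ *: _).
suff UE s : U gamma s = comp_par s by apply: eq_alt => tau.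
apply: eq_at_points => // u; rewrite /comp; apply: eq_at_points => [v|i le_iq]; last first.
  by rewrite gE ltnS le_iq.
apply: eq_at_points => // -[_|[_|j _]] /=.
- by congr (_, _); apply: eq_wt => i lt_iq; rewrite gE lt_iq.
- by rewrite gE addn0 ltnn eqxx.
- by rewrite gE ltnNge leq_addr /= -{2}[q.+1]addn0 eqn_add2l /= addnS /= twistD addnS addSn.
Qed.

(** The value of [e] can occupy q+1 positions in [g], giving nested terms, or p positions in [f],
    giving parallel ones; the other n points are then arranged in n! ways. *)
Lemma alt_comp_circl :
  alt N.+1 (comp alpha (circ alpha f g : precochain L n) e h) t *+ (q.+1`! * p`!) =
  (alt N.+1 comp3 t *+ q.+1 + ((-1) ^+ q.+1 *: alt N.+1 comp_par t) *+ p) *+ n`!.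
Proof.
have le_qn : (q <= n)%N by lia.
rewrite -altMn; transitivity (\sum_rho G rho).
  rewrite -alt_sum => [|rho b]; last exact: mulrC.
  apply: eq_alt => tau; set s := fun i => t (perm_nat tau i).
  have sh : weight_hom iota (weight N.+1 s) h by rewrite weight_perm.
  rewrite -at_points_sum -at_pointsMn; apply: eq_at_points => // u.
  by apply: etrans (at_points_circ_alt nE fC gC _) _; rewrite ?weight_inner.
have -> : p = (n - q)%N by lia.
apply: sum_perm_preimage => // rho.
  set i := (rho^-1)%g ord0 => le_iq.
  (* After this exchange inside the block of [g] the permutation fixes [ord0]. *)
  rewrite -(@G_block ord0 i) ?leq0n ?le_iq // -[(tperm _ _ * _)%g]mul1g G_fix ?G_id //.
  by rewrite permM tpermL /i permKV.
set i := (rho^-1)%g ord0 => lt_qi.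
have lt_qn : (q.+1 < n.+1)%N by have := ltn_ord i; lia.
(* The cycle that places point 0 at position q+1, the first slot of [f] after the value of [g]. *)
have [gamma og gE] := nat_perm_offset (a := 0) lt_qn (nat_perm_cycle q.+1).
have {}gE j : perm_nat gamma j = if (j < q.+1)%N then j.+1 else if j == q.+1 then 0%N else j.
  by rewrite -gE /offset subn0.
rewrite -(G_cycle og gE) -(@G_block (Ordinal lt_qn) i) /=; last by lia.
rewrite -[(tperm _ _ * _)%g](mulKVg gamma) G_fix // permM.
have -> : (gamma^-1)%g ord0 = Ordinal lt_qn.
  apply: (@perm_inj _ gamma); rewrite permKV; apply: val_inj => /=.
  by rewrite -perm_nat_ord gE /= ltnn eqxx.
by rewrite permM tpermL /i permKV.
Qed.

End Right.

(** The first two slots of [f] are exchanged, which gives the sign. Beforehand alpha^k is pulled out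
    of [g], and afterwards alpha^q is pushed into [e], so that the result has the shape of
    [comp_par] with [g] and [e] interchanged. Two slots exist since p > 0. *)
Lemma comp_par_block s : (0 < p)%N -> weight_hom iota (weight N.+1 s) h -> comp_par s =
  - at_points g (fun v => at_points e (fun u => at_points f h
       (seq_cons (weight k.+1 s, u) (seq_cons (weight q.+1 (fun i => s (k.+1 + i)%N),
         iter k alpha v)
          (fun j => pt (q + k) (s (k.+1 + (q.+1 + j))%N)))))
       (fun i => pt q (s i))) (fun i => s (k.+1 + i)%N).
Proof.
move=> p0 sh; pose A := weight k.+1 s; pose B := weight q.+1 (fun i => s (k.+1 + i)%N).
pose R j := pt (q + k) (s (k.+1 + (q.+1 + j))%N).
have wtN : weight N.+1 s = A + (B + weight p.-1 R).
  have -> : N.+1 = (k.+1 + (q.+1 + p.-1))%N by lia.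
  by rewrite !weight_add; congr (_ + (_ + _)); apply: eq_wt.
have wtB u : weight_hom iota B (fun v => at_points f h (seq_cons (B, v) (seq_cons (A, u) R))).
  apply: (weight_hom_at_points fC); rewrite -(prednK p0) weight_cns /= addrCA -wtN.
  exact: sh.
have wtA v : weight_hom iota A (fun u => at_points f h (seq_cons (A, u) (seq_cons (B, v) R))).
  by apply: (weight_hom_at_points fC); rewrite -(prednK p0) weight_cns /= -wtN.
have swapE u v : at_points f h (seq_cons (B, v) (seq_cons (A, u) R)) =
    - at_points f h (seq_cons (A, u) (seq_cons (B, v) R)).
  rewrite -scaleN1r -(at_points_nat_perm (iota := iota) (b := true) (phi := swap 0 1) fC).
  - by apply: eq_at_points => // -[|[|j]].
  - by rewrite weight_cns -(prednK p0) weight_cns /= -wtN.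
  - exact: nat_perm_swap.
transitivity (at_points e (fun u => at_points g (fun v =>
    at_points f h (seq_cons (B, iter k alpha v) (seq_cons (A, iter q alpha u) R)))
    (fun i => s (k.+1 + i)%N)) s).
  apply: eq_at_points => // u.
  by rewrite -(at_points_iter_alpha alpha_lin gC _ _ (wtB _)).
rewrite at_points_swap -scaleN1r -at_points_scale; apply: eq_at_points => // v.
rewrite -(at_points_iter_alpha alpha_lin eC _ _ (wtA _)) -at_points_scale.
by apply: eq_at_points => // u; rewrite swapE scaleN1r.
Qed.

End Three.

Section Associator.
Variables (p q k N : nat).
Variables (f : precochain L p) (g : precochain L q) (e : precochain L k).
Hypotheses (fC : is_cochain alpha f) (gC : is_cochain alpha g) (eC : is_cochain alpha e).
Hypothesis NE : N = (p + q + k)%N.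
Variables (h : L -> W) (t : nat -> point).
Hypothesis th : weight_hom iota (weight N.+1 t) h.

(** The block permutation of the q+1 and k+1 arguments gives (-1)^((q+1)(k+1)); the further minus
    sign is that of [comp_par_block]. *)
Lemma alt_comp_par_swap : (0 < p)%N ->
  alt N.+1 (comp_par f g e h) t =
  - (-1) ^+ (q.+1 * k.+1) *: alt N.+1 (comp_par f e g h) t.
Proof.
move=> p0; have le_N : (0 + (q.+1 + k.+1) <= N.+1)%N by lia.
have := nat_perm_offset le_N (nat_perm_block q.+1 k.+1).
set phi := offset 0 _ => phiN.
rewrite scaleNr -signr_odd -(alt_nat_perm (comp_par f e g h) t phiN).
apply: etrans _ (etrans (alt_sign N.+1 _ true t) (scaleN1r _)).
have phiE i : phi i = if (i < q.+1)%N then (k.+1 + i)%N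
    else if (i < q.+1 + k.+1)%N then (i - q.+1)%N else i.
  by rewrite /phi /offset subn0.
apply: eq_alt => tau; set s := fun i => t (perm_nat tau i).
have sh : weight_hom iota (weight N.+1 s) h by rewrite weight_perm.
rewrite (comp_par_block fC gC eC NE p0 sh) scaleN1r; congr (- _).
apply: eq_at_points => [v|i le_iq]; last by rewrite phiE ltnS le_iq.
apply: eq_at_points => [u|i le_ik]; last first.
  by rewrite phiE ltnNge leq_addr ltn_add2l ltnS le_ik addKn.
apply: eq_at_points => // -[_|[_|j _]] /=.
- congr (_, _); apply: eq_wt => i lt_ik.
  by rewrite phiE ltnNge leq_addr ltn_add2l lt_ik addKn.
- by congr (_, _); apply: eq_wt => i lt_iq; rewrite phiE lt_iq.
- rewrite phiE ltnNge leq_addr /= ltn_add2l ltnNge leq_addr /=.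
  by rewrite [(k + q)%N]addnC addnCA.
Qed.

(** With the common factor, both compositions contain the nested term q+1 times: in the second one
    this multiplicity is (q+1)!/q!. Only the parallel term remains. *)
Lemma at_points_associator n m : n = (p + q)%N -> m = (q + k)%N ->
  (at_points (circ alpha (circ alpha f g : precochain L n) e : precochain L N) h t -
   at_points (circ alpha f (circ alpha g e : precochain L m) : precochain L N) h t)
     *+ (k.+1`! * q.+1`! * p`!) =
  ((-1) ^+ q.+1 *: alt N.+1 (comp_par f g e h) t) *+ p.
Proof.
move=> nE mE.
have fgC := circ_cochain alpha_lin char0 nE fC gC.
have geC := circ_cochain alpha_lin char0 mE gC eC.
have NnE : N = (n + k)%N by lia.
have NmE : N = (p + m)%N by lia.
have fact0 j : (0 < j`!)%N by exact: fact_gt0.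
have El : at_points (circ alpha (circ alpha f g : precochain L n) e : precochain L N) h t
    *+ (k.+1`! * q.+1`! * p`!) =
    alt N.+1 (comp3 f g e h) t *+ q.+1 + ((-1) ^+ q.+1 *: alt N.+1 (comp_par f g e h) t) *+ p.
  apply: (mulrn_inj char0 iota (fact0 n)).
  rewrite -(alt_comp_circl e fC gC NE nE th) -(at_points_circ_alt NnE fgC eC th) -!mulrnA.
  by congr (_ *+ _); ring.
have Er : at_points (circ alpha f (circ alpha g e : precochain L m) : precochain L N) h t
    *+ (k.+1`! * q`! * p`!) = alt N.+1 (comp3 f g e h) t.
  apply: (mulrn_inj char0 iota (fact0 m.+1)).
  rewrite -(alt_comp_circr fC gC eC NE mE th) -(at_points_circ_alt NmE fC geC th) -!mulrnA.
  by congr (_ *+ _); ring.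
have {}Er : at_points (circ alpha f (circ alpha g e : precochain L m) : precochain L N) h t
    *+ (k.+1`! * q.+1`! * p`!) = alt N.+1 (comp3 f g e h) t *+ q.+1.
  by rewrite -Er -mulrnA (factS q); congr (_ *+ _); ring.
rewrite mulrnBl; apply: etrans (f_equal2 (fun x y => x - y) El Er) _.
by rewrite addrAC subrr add0r.
Qed.

End Associator.

Lemma at_points_preLie p q k N n m n' m' (f : precochain L p) (g : precochain L q)
    (e : precochain L k) h t :
    is_cochain alpha f -> is_cochain alpha g -> is_cochain alpha e ->
    N = (p + q + k)%N -> n = (p + q)%N -> m = (q + k)%N -> n' = (p + k)%N -> m' = (k + q)%N ->
    weight_hom iota (weight N.+1 t) h ->
  at_points (circ alpha (circ alpha f g : precochain L n) e : precochain L N) h t -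
  at_points (circ alpha f (circ alpha g e : precochain L m) : precochain L N) h t =
  (-1) ^+ (q * k) *:
    (at_points (circ alpha (circ alpha f e : precochain L n') g : precochain L N) h t -
     at_points (circ alpha f (circ alpha e g : precochain L m') : precochain L N) h t).
Proof.
move=> fC gC eC NE nE mE nE' mE' th.
have NE' : N = (p + k + q)%N by lia.
apply: (mulrn_inj char0 iota (n := k.+1`! * q.+1`! * p`!)).
  by rewrite !muln_gt0 !fact_gt0.
rewrite (at_points_associator fC gC eC NE th nE mE) [RHS]scalerMnr.
rewrite [(k.+1`! * _)%N]mulnC (at_points_associator fC eC gC NE' th nE' mE').
(* A unary [f] cannot take two inner values: for p = 0 the multiplicity p makes both associators
   vanish. *)
case: (posnP p) => [p0|p0].
  have E0 (w : W) : w *+ p = 0 by rewrite p0.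
  by rewrite !E0 scaler0.
rewrite (alt_comp_par_swap fC gC eC NE th p0) -[RHS]scalerMnr !scalerA; congr (_ *: _ *+ _).
(* Modulo 2, (q+1) + 1 + (q+1)(k+1) equals qk + (k+1). *)
rewrite mulrN -exprD -[RHS]exprD -mulN1r -exprS -signr_odd -[RHS]signr_odd.
by congr (_ ^+ nat_of_bool _); rewrite /= !(oddD, oddM) /=; case: (odd q); case: (odd k).
Qed.

End PreLie.

(** * The bracket *)

Section Linearity.
Variables (F : fieldType) (L : lmodType {poly F}) (alpha : L -> L).
Hypothesis alpha_lin : forall p u v, alpha (p *: u + v) = p *: alpha u + alpha v.
Hypothesis char0 : forall n, n.+1%:R != 0 :> F.

(** The form of [gcomb] in a single arity. The bracket is itself an instance, with a sign as
    coefficient ([NR_comb]). *)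
Definition comb p (a : F) (f f' : precochain L p) : precochain L p :=
  fun x => a%:P%:MP *: f x + f' x.

Section Values.
Variables (K : comNzRingType) (iota : {rmorphism F -> K}) (W : lmodType K).
Implicit Types (h : L -> W) (t : nat -> K * L).

Lemma at_points_comb p a (f f' : precochain L p) h t : weight_hom iota (weight p.+1 t) h ->
  at_points (comb a f f') h t = iota a *: at_points f h t + at_points f' h t.
Proof.
move=> th; rewrite /at_points /comb.
apply: etrans (vextD _ _ _ (weight_homD th)) _.
by rewrite (vext_scale _ _ _ th) evC evpC.
Qed.

Section Comb.
Variables (p : nat) (a : F) (f f' : precochain L p).
Hypotheses (fC : is_cochain alpha f) (fC' : is_cochain alpha f').

Lemma at_points_comb_alpha h t : weight_hom iota (weight p.+1 t) h ->
  at_points (comb a f f') (fun u => h (alpha u)) t =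
  at_points (comb a f f') h (fun i => twist alpha 1 (t i)).
Proof.
move=> th; apply: etrans (at_points_comb a f f' (weight_hom_alpha alpha_lin th)) _.
have th' : weight_hom iota (weight p.+1 (fun i => twist alpha 1 (t i))) h
  by rewrite (eq_wt (t' := t)).
apply: etrans _ (esym (at_points_comb a f f' th')).
by rewrite (at_points_alpha alpha_lin fC _ th) (at_points_alpha alpha_lin fC' _ th).
Qed.

Lemma at_points_comb_perm h t (tau : 'S_p.+1) : weight_hom iota (weight p.+1 t) h ->
  at_points (comb a f f') h (fun i => t (perm_nat tau i)) =
  (-1) ^+ odd_perm tau *: at_points (comb a f f') h t.
Proof.
move=> th; have th' : weight_hom iota (weight p.+1 (fun i => t (perm_nat tau i))) h
  by rewrite weight_perm.
apply: etrans (at_points_comb a f f' th') _.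
apply: etrans _ (congr1 ( *:%R _) (esym (at_points_comb a f f' th))).
by rewrite (at_points_perm fC _ th) (at_points_perm fC' _ th) scalerDr !scalerA mulrC.
Qed.

End Comb.

Lemma at_points0 p (f : precochain L p) h t : (forall x, f x = 0) -> at_points f h t = 0.
Proof. by move=> f0; rewrite /at_points f0 vext0. Qed.

Lemma at_points_cst0 p (f : precochain L p) h t : (forall u, h u = 0) -> at_points f h t = 0.
Proof. by move=> h0; rewrite /at_points /vext big1 // => m _; rewrite h0 scaler0. Qed.

Section Circ.
Variables (p q r : nat).
Hypothesis rE : r = (p + q)%N.

Let wtE t : weight q.+1 t + weight p (fun j => twist alpha q (t (q.+1 + j)%N)) = weight r.+1 t.
Proof. by rewrite rE [in RHS]addnC -addSn weight_add. Qed.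

Lemma at_points_circ_combr a (f : precochain L p) (g g' : precochain L q) h t :
    is_cochain alpha f -> weight_hom iota (weight r.+1 t) h ->
  at_points (circ alpha f (comb a g g') : precochain L r) h t =
  iota a *: at_points (circ alpha f g : precochain L r) h t +
  at_points (circ alpha f g' : precochain L r) h t.
Proof.
move=> fC th; apply: etrans (at_points_circ alpha f (comb a g g') rE th) _.
apply: etrans _ (esym (f_equal2 (fun v w => iota a *: v + w)
  (at_points_circ alpha f g rE th) (at_points_circ alpha f g' rE th))).
rewrite scaler_sumr -big_split.
apply: eq_bigr => tau _ /=; rewrite scalerA mulrC -scalerA -scalerDr; congr (_ *: _).
apply: at_points_comb; apply: (weight_hom_at_points fC).
by rewrite wtE weight_perm; exact: th.
Qed.

Lemma at_points_circ_combl a (f f' : precochain L p) (g : precochain L q) h t :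
    weight_hom iota (weight r.+1 t) h ->
  at_points (circ alpha (comb a f f') g : precochain L r) h t =
  iota a *: at_points (circ alpha f g : precochain L r) h t +
  at_points (circ alpha f' g : precochain L r) h t.
Proof.
move=> th; apply: etrans (at_points_circ alpha (comb a f f') g rE th) _.
apply: etrans _ (esym (f_equal2 (fun v w => iota a *: v + w)
  (at_points_circ alpha f g rE th) (at_points_circ alpha f' g rE th))).
rewrite scaler_sumr -big_split.
apply: eq_bigr => tau _ /=; rewrite scalerA mulrC -scalerA -scalerDr; congr (_ *: _).
rewrite -at_points_lin; apply: eq_at_points => // u.
by apply: at_points_comb; rewrite weight_cns wtE weight_perm; exact: th.
Qed.

Lemma at_points_circ0r (f : precochain L p) (g : precochain L q) h t :
    is_cochain alpha f -> weight_hom iota (weight r.+1 t) h ->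
    (forall h t, weight_hom iota (weight q.+1 t) h -> at_points g h t = 0) ->
  at_points (circ alpha f g : precochain L r) h t = 0.
Proof.
move=> fC th g0; rewrite (at_points_circ _ _ _ rE th) big1 // => tau _.
rewrite /comp g0 ?scaler0 //; apply: (weight_hom_at_points fC).
by rewrite wtE weight_perm; exact: th.
Qed.

Lemma at_points_circ0l (f : precochain L p) (g : precochain L q) h t :
    weight_hom iota (weight r.+1 t) h ->
    (forall h t, weight_hom iota (weight p.+1 t) h -> at_points f h t = 0) ->
  at_points (circ alpha f g : precochain L r) h t = 0.
Proof.
move=> th f0; rewrite (at_points_circ _ _ _ rE th) big1 // => tau _.
rewrite /comp at_points_cst0 ?scaler0 // => u; apply: f0.
by rewrite weight_cns wtE weight_perm; exact: th.
Qed.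

End Circ.
End Values.

(** Instantiated at the generic points with the test map [value]. *)
Lemma precochain_eq r (f f' : precochain L r) x :
  (forall (K : comNzRingType) (iota : {rmorphism F -> K}) (W : lmodType K) (h : L -> W) t,
     weight_hom iota (weight r.+1 t) h -> at_points f h t = at_points f' h t) ->
  f x = f' x.
Proof.
move=> ff'; rewrite -at_points_lam -[RHS]at_points_lam.
apply: (ff' _ (scal F r)); rewrite weight_lam_points; exact: weight_hom_value.
Qed.

Lemma NR_comb p q (f : precochain L p) (g : precochain L q) :
  NR alpha f g = comb (- (-1) ^+ (p * q)) (circ alpha g f) (circ alpha f g).
Proof.
apply: functional_extensionality => x; rewrite /NR /comb addrC; apply: (congr1 (+%R^~ _)).
rewrite -scaleNr; apply: (congr1 ( *:%R^~ _)).
have -> c : c%:P%:MP = scal F (p + q) c by [].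
by rewrite rmorphN rmorphXn rmorphN1.
Qed.

Lemma cochain_slot r (f : precochain L r) (x : {ffun 'I_r.+1 -> L}) i : is_cochain alpha f ->
  weight_hom (W := vpoly L r) (scal F r) (lam i) (fun u => f (upd x i u)).
Proof.
move=> fC; have E u : f (upd x i u) =
    at_points (K := mpoly r {poly F}) (W := vpoly L r) f (@value F L r)
      (seq_set (lam_points x) i (lam i, u)).
  apply: etrans (esym (at_points_lam f _)) _; apply: eq_at_points => // j le_jr.
  rewrite /lam_points /seq_set ffunE -val_eqE /= inordK //; case: eqP => // ->.
  by rewrite inord_val.
rewrite (functional_extensionality _ _ E); apply: (at_points_slot fC); first by rewrite -ltnS.
have -> : weight r.+1 (seq_set (lam_points x) i (lam i, 0)) = weight r.+1 (lam_points x).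
  by apply: eq_wt => j _; rewrite /seq_set; case: eqP => // ->; rewrite /= inord_val.
by rewrite weight_lam_points; exact: weight_hom_value.
Qed.

Lemma comb_cochain r a (f f' : precochain L r) :
  is_cochain alpha f -> is_cochain alpha f' -> is_cochain alpha (comb a f f').
Proof.
move=> fC fC'.
have th (x : {ffun 'I_r.+1 -> L}) : weight_hom (scal F r) (weight r.+1 (lam_points x)) (@value F
  L r).
  by rewrite weight_lam_points; exact: weight_hom_value.
apply: (cochain_lam_points alpha_lin) => [x i|x|tau x].
- pose c (b : bool) := if b then scal F r a else 1.
  pose g (b : bool) u := if b then f (upd x i u) else f' (upd x i u).
  have E u : comb a f f' (upd x i u) = \sum_b c b *: g b u.
    by rewrite big_bool /=; apply: (congr1 (+%R _)); rewrite scale1r.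
  rewrite (functional_extensionality _ _ E).
  apply: (@weight_hom_sum _ _ (mpoly r {poly F}) (scal F r) (vpoly L r) _ predT (lam i) c g).
  by case=> _; [exact: (cochain_slot x i fC) | exact: (cochain_slot x i fC')].
- exact (@at_points_comb_alpha (mpoly r {poly F}) (scal F r) (vpoly L r) r a f f' fC fC'
    (@value F L r) (lam_points x) (th x)).
- exact (@at_points_comb_perm (mpoly r {poly F}) (scal F r) (vpoly L r) r a f f' fC fC'
    (@value F L r) (lam_points x) tau (th x)).
Qed.

Lemma zero_cochain r : is_cochain alpha (fun=> 0 : vpoly L r).
Proof.
pose K := mpoly r {poly F}; pose W := vpoly L r.
have z h t : at_points (K := K) (W := W) (fun=> 0 : vpoly L r) h t = 0 by exact: at_points0.
apply: (cochain_lam_points alpha_lin) => [x i p u v|x|tau x].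
- by rewrite scaler0 addr0.
- exact (etrans (z (fun u => value r (alpha u)) (lam_points x))
    (esym (z (@value F L r) (fun i => twist alpha 1 (lam_points x i))))).
- apply: etrans (z (@value F L r) _) (esym _).
  exact (etrans (congr1 ( *:%R _) (z (@value F L r) (lam_points x))) (scaler0 _ _)).
Qed.

Lemma NR_cochain p q (f : precochain L p) (g : precochain L q) :
  is_cochain alpha f -> is_cochain alpha g -> is_cochain alpha (NR alpha f g).
Proof.
move=> fC gC; rewrite NR_comb; apply: comb_cochain.
  by apply: circ_cochain => //; rewrite addnC.
exact: circ_cochain.
Qed.

Lemma comb_subZ (K : comNzRingType) (W : lmodType K) (a s : K) (x x' y y' : W) :
  (a *: x + x') - s *: (a *: y + y') = a *: (x - s *: y) + (x' - s *: y').
Proof.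
by rewrite !scalerDr scalerN !scalerA [s * a]mulrC opprD addrACA.
Qed.

Section NR.
Variables (K : comNzRingType) (iota : {rmorphism F -> K}) (W : lmodType K).
Variables (p q : nat) (f : precochain L p).
Implicit Types (h : L -> W) (t : nat -> K * L).

Lemma at_points_NR (g : precochain L q) h t : weight_hom iota (weight (p + q).+1 t) h ->
  at_points (NR alpha f g) h t = at_points (circ alpha f g : precochain L (p + q)) h t -
    (-1) ^+ (p * q) *: at_points (circ alpha g f : precochain L (p + q)) h t.
Proof.
move=> th; rewrite NR_comb; apply: etrans (at_points_comb _ _ _ th) _.
by rewrite addrC rmorphN rmorphXn rmorphN1 scaleNr.
Qed.

Lemma at_points_NR_comb (g g' : precochain L q) a h t :
    is_cochain alpha f -> weight_hom iota (weight (p + q).+1 t) h ->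
  at_points (NR alpha f (comb a g g')) h t =
  iota a *: at_points (NR alpha f g) h t + at_points (NR alpha f g') h t.
Proof.
move=> fC th; have qpE : (p + q = q + p)%N by rewrite addnC.
apply: etrans (at_points_NR _ th) _.
apply: etrans (f_equal2 (fun v w => v - _ *: w)
  (at_points_circ_combr erefl a g g' fC th) (at_points_circ_combl qpE a g g' f th)) _.
apply: etrans _ (esym (f_equal2 (fun v w => iota a *: v + w)
  (at_points_NR g th) (at_points_NR g' th))).
exact: comb_subZ.
Qed.

Lemma at_points_NR0 (g : precochain L q) h t :
    is_cochain alpha f -> (forall x, g x = 0) -> weight_hom iota (weight (p + q).+1 t) h ->
  at_points (NR alpha f g) h t = 0.
Proof.
move=> fC g0 th; have qpE : (p + q = q + p)%N by rewrite addnC.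
have z (h' : L -> W) t' : weight_hom iota (weight q.+1 t') h' -> at_points g h' t' = 0.
  by move=> _; exact: at_points0.
apply: etrans (at_points_NR _ th) _.
apply: etrans (f_equal2 (fun v w => v - _ *: w)
  (at_points_circ0r erefl fC th z) (at_points_circ0l qpE f th z)) _.
by rewrite scaler0 subr0.
Qed.

End NR.

(** The letters stand for Z = (m.m).f, M = m.(m.f), A = (m.f).m, B = m.(f.m), C = (f.m).m and D =
    f.(m.m). The second identity gives 2(C - D) = 0, hence C = 0. *)
Lemma pre_lie_odd_square (K : comNzRingType) (iota : {rmorphism F -> K}) (W : lmodType K) q
    (A B C D M Z : W) :
    Z - M = (-1) ^+ (1 * q) *: (A - B) -> C - D = (-1) ^+ (1 * 1) *: (C - D) ->
    Z = 0 -> D = 0 ->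
  (- (-1) ^+ (1 * q) *: B + M) - (-1) ^+ (1 * (1 + q)) *: (- (-1) ^+ (1 * q) *: C + A) = 0.
Proof.
move=> ZM CD Z0 D0.
have C0 : C = 0.
  apply: (mulrn_inj char0 iota (n := 2)) => //; rewrite mul0rn mulr2n.
  by move: CD; rewrite D0 subr0 mul1n expr1 scaleN1r => {1}->; rewrite addNr.
have M_E : M = - ((-1) ^+ q *: (A - B)) by rewrite -[q in RHS]mul1n -ZM Z0 sub0r opprK.
rewrite C0 scaler0 add0r M_E !mul1n exprS mulN1r !scaleNr opprK scalerBr.
by rewrite opprB addKr addNr.
Qed.

(* As [m] is odd, the pre-Lie identity for (f, m, m) gives (f.m).m = f.(m.m) = 0,
   and the one for (m, m, f) cancels the remaining terms against (m.m).f = 0. *)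
Lemma at_points_NR_NR_odd (K : comNzRingType) (iota : {rmorphism F -> K}) (W : lmodType K)
    q (m : precochain L 1) (f : precochain L q) (h : L -> W) t :
    is_cochain alpha m -> is_cochain alpha f ->
    (forall x, (circ alpha m m : precochain L 2) x = 0) ->
    weight_hom iota (weight (1 + (1 + q)).+1 t) h ->
  at_points (NR alpha m (NR alpha m f)) h t = 0.
Proof.
move=> mC fC mm0 th.
have E1 : (1 + (1 + q) = 1 + q + 1)%N by lia.
have E2 : (1 + (1 + q) = q + 1 + 1)%N by lia.
have E3 : (1 + q = q + 1)%N by lia.
have E4 : (1 + (1 + q) = 2 + q)%N by lia.
have E5 : (1 + (1 + q) = q + 2)%N by lia.
have E6 : (1 + (1 + q) = 1 + 1 + q)%N by lia.
have z (h' : L -> W) t' : weight_hom iota (weight 3 t') h' ->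
    at_points (circ alpha m m : precochain L 2) h' t' = 0.
  by move=> _; exact: at_points0.
have P1 := at_points_preLie alpha_lin char0 mC mC fC E6 erefl erefl erefl E3 th.
have P2 := at_points_preLie alpha_lin char0 fC mC mC E2 E3 erefl E3 erefl th.
have Z1 := at_points_circ0l E4 f th z.
have Z2 := at_points_circ0r E5 fC th z.
pose X := circ alpha m f : precochain L (1 + q).
pose Y := circ alpha f m : precochain L (1 + q).
have D0 := at_points_NR m (NR alpha m f) th.
have Dr := at_points_circ_combr (erefl (1 + (1 + q))) (- (-1) ^+ (1 * q)) Y X mC th.
have Dl := at_points_circ_combl E1 (- (-1) ^+ (1 * q)) Y X m th.
rewrite -NR_comb in Dr Dl.
apply: etrans D0 _; apply: etrans (f_equal2 (fun v w => v - _ *: w) Dr Dl) _.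
rewrite rmorphN rmorphXn rmorphN1; exact: (pre_lie_odd_square iota P1 P2 Z1 Z2).
Qed.

Lemma NR_combr p q (f : precochain L p) (g g' : precochain L q) a x : is_cochain alpha f ->
  NR alpha f (comb a g g') x = comb a (NR alpha f g) (NR alpha f g') x.
Proof.
move=> fC; apply: precochain_eq => K iota W h t th.
by apply: etrans (at_points_NR_comb _ _ _ fC th) (esym (at_points_comb _ _ _ th)).
Qed.

Lemma NR0r p q (f : precochain L p) (g : precochain L q) x : is_cochain alpha f ->
  (forall y, g y = 0) -> NR alpha f g x = 0.
Proof.
move=> fC g0; apply: (precochain_eq (f' := fun=> 0)) => K iota W h t th.
by apply: etrans (at_points_NR0 fC g0 th) (esym (at_points0 _ _ _)).
Qed.

Lemma NR_NR_odd q (m : precochain L 1) (f : precochain L q) x :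
    is_cochain alpha m -> is_cochain alpha f ->
    (forall y, (circ alpha m m : precochain L 2) y = 0) ->
  NR alpha m (NR alpha m f) x = 0.
Proof.
move=> mC fC mm0; apply: (precochain_eq (f' := fun=> 0)) => K iota W h t th.
by apply: etrans (at_points_NR_NR_odd mC fC mm0 th) (esym (at_points0 _ _ _)).
Qed.

End Linearity.

(** * Hom-Lie conformal algebras *)

Section HomLie.
Variables (F : fieldType) (L : lmodType {poly F}).
Variables (br : L -> L -> vpoly L 1) (alpha : L -> L).
Hypothesis hL : is_hom_lie_conformal br alpha.
Hypothesis hmult : multiplicative_hlc br alpha.
Hypothesis char0 : forall n, n.+1%:R != 0 :> F.

Lemma hlc_alpha_scale_add p u v : alpha (p *: u + v) = p *: alpha u + alpha v.
Proof.
(* For [A = - 'X] the map [evp A] is the identity of [{poly F}], so [weight_hom] is plain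
   linearity. *)
have H : weight_hom (W := L) (polyC : {rmorphism F -> {poly F}}) (- 'X) alpha.
  apply: weight_hom_scale_add => [c x y|x]; first exact: (hlc_alpha_lin hL).
  by rewrite opprK; exact: (hlc_alpha_partial hL).
rewrite H; congr (_ *: _ + _).
by rewrite /evp /horner_morph opprK -[RHS]comp_polyXr.
Qed.

Section Values.
Variables (K : comNzRingType) (iota : {rmorphism F -> K}) (W : lmodType K).
Implicit Types (A B C : K) (h : L -> W) (t : nat -> K * L).

Definition br_ev h A (x y : L) : W := vext (fun _ : 'I_1 => A) h (br x y).

Lemma at_points_m_c h t : at_points (m_c br) h t = br_ev h (t 0%N).1 (t 0%N).2 (t 1%N).2.
Proof.
rewrite /at_points /m_c !ffunE /br_ev; apply: eq_vext => // i.
by rewrite (ord1 i).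
Qed.

Lemma br_evN h A x y : br_ev (fun u => - h u) A x y = - br_ev h A x y.
Proof. by rewrite /br_ev /vext -sumrN; apply: eq_bigr => m _; rewrite scalerN. Qed.

(** With d equal to -(A + B) on the target, the parameter -A - d of the reversed bracket is B. *)
Lemma br_ev_skew h A B x y : weight_hom iota (A + B) h -> br_ev h A x y = - br_ev h B y x.
Proof.
move=> ABh; pose t i : K * L := if i == 0%N then (A, x) else (B, y).
have mC := m_c_cochain hL hmult.
have th : weight_hom iota (weight 2 t) h by rewrite /weight big_ord_recl big_ord1.
have := at_points_nat_perm (b := true) (phi := swap 0 1) mC th (nat_perm_swap _ _ _).
by rewrite !at_points_m_c /= scaleN1r => -> //; rewrite opprK.
Qed.

(** The Hom-Jacobi identity at l = A, mu = B, with [C] as the parameter of the third argument. *)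
Lemma br_ev_jacobi h A B C x y z : weight_hom iota (A + B + C) h ->
  br_ev (fun u => br_ev h A (alpha x) u) B y z =
  br_ev (fun u => br_ev h (A + B) u (alpha z)) A x y +
  br_ev (fun u => br_ev h B (alpha y) u) A x z.
Proof.
move=> Ah; pose E (i : 'I_2) := if i == ord0 then A else B.
have := hlc_jacobi hL x y z => /= /(congr1 (vext E h)).
have E0 : ev iota E (A + B + C) 'X_ord0 = A by rewrite evX.
have E1 : ev iota E (A + B + C) 'X_ord_max = B by rewrite evX.
have atE (D : mpoly 2 {poly F}) u v :
    vext E h (br_at br D u v) = br_ev h (ev iota E (A + B + C) D) u v.
  apply: etrans (vext_vext _ _ _ _ Ah) _; apply: eq_vext => // w.
  exact: vext_value Ah.
have extE (D : mpoly 2 {poly F}) (g : L -> vpoly L 2) u v :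
    vext E h (vextend (fun=> D) g (br u v)) =
    br_ev (fun w => vext E h (g w)) (ev iota E (A + B + C) D) u v.
  exact: vext_vext Ah.
move=> J; apply: etrans (etrans _ J) _.
  rewrite extE E1; apply: eq_vext => // u; by rewrite atE E0.
apply: etrans (vextD _ _ _ (weight_homD Ah)) _.
apply: etrans (f_equal2 +%R (extE _ _ _ _) (extE _ _ _ _)) _; rewrite E0.
apply: (f_equal2 +%R); apply: eq_vext => // u.
  by rewrite atE rmorphD E0 E1.
by rewrite atE E1.
Qed.

(** Write T(x,y,z) = [[x y] alpha z]. By skew-symmetry the Hom-Jacobi identity reads -T(y,z,x) =
    T(x,y,z) - T(x,z,y). Alternation turns the left side into -alt T, the cycle being even, and the
    right side into 2 alt T. *)
Lemma at_points_m_c_m_c h t : weight_hom iota (weight 3 t) h ->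
  at_points (circ alpha (m_c br) (m_c br) : precochain L 2) h t = 0.
Proof.
move=> th; have mC := m_c_cochain hL hmult.
apply: (mulrn_inj char0 iota (n := 2`! * 1`!)) => //; rewrite mul0rn.
apply: etrans (at_points_circ_alt (erefl 2) mC mC th) _.
pose T := comp alpha (m_c br) (m_c br) h.
have TE s : T s = br_ev (fun u => br_ev h ((s 0%N).1 + (s 1%N).1) u (alpha (s 2).2))
    (s 0%N).1 (s 0%N).2 (s 1%N).2.
  rewrite /T /comp at_points_m_c; apply: eq_vext => // u.
  by rewrite at_points_m_c /= /weight big_ord_recl big_ord1.
pose cyc i := if (i < 2)%N then i.+1 else if i == 2%N then 0%N else i.
have altE : alt 3 (fun s => - T (fun i => s (cyc i))) t =
    alt 3 (fun s => T s + - T (fun i => s (swap 1 2 i))) t.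
  apply: eq_alt => tau; set s := fun i => t (perm_nat tau i).
  have sh : weight_hom iota ((s 0%N).1 + (s 1%N).1 + (s 2).1) h.
    by move: th; rewrite -(weight_perm tau) /weight !big_ord_recl big_ord0 addr0 addrA.
  rewrite !TE /cyc /swap /= -!br_evN.
  have := br_ev_jacobi (s 0%N).2 (s 1%N).2 (s 2).2 sh => J.
  apply: etrans (etrans _ J) _; [|apply: (f_equal2 +%R) => //].
    apply: eq_vext => // u; rewrite (@br_ev_skew _ (s 0%N).1 ((s 1%N).1 + (s 2).1)) ?opprK //.
    by rewrite addrA.
  apply: eq_vext => // u; rewrite (@br_ev_skew _ (s 1%N).1 ((s 0%N).1 + (s 2).1)) ?opprK //.
  by rewrite addrCA addrA.
have cycN : nat_perm 3 false cyc := nat_perm_cycle 2.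
have swapN : nat_perm 3 true (swap 1 2) by exact: nat_perm_swap.
move: altE; rewrite altD !altN (alt_nat_perm T t cycN) (alt_nat_perm T t swapN).
rewrite scale1r scaleN1r opprK -/T => altE.
(* From -alt T = 2 alt T follows 3 alt T = 0. *)
apply: (mulrn_inj char0 iota (n := 3)) => //; rewrite mul0rn mulrSr mulr2n -altE.
exact: addNr.
Qed.

End Values.

Lemma circ_m_c_m_c x : (circ alpha (m_c br) (m_c br) : precochain L 2) x = 0.
Proof.
apply: (precochain_eq (f' := fun=> 0)) => K iota W h t th.
by apply: etrans (at_points_m_c_m_c th) (esym (at_points0 _ _ _)).
Qed.

End HomLie.

(* The differential on the graded space of cochains *)
From mathcomp Require Import reals complex.
Unset Implicit Arguments.

Theorem proposition3p1 (R : realType) (L : lmodType {poly R[i]})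
    (br : L -> L -> vpoly L 1) (alpha : L -> L)
    (hL : is_hom_lie_conformal br alpha)
    (hmult : multiplicative_hlc br alpha) :
  let d := d_NR alpha (m_c br) in
  [/\ forall c, in_Cstar alpha c -> in_Cstar alpha (d c),
      forall (a : R[i]) c c', in_Cstar alpha c -> in_Cstar alpha c' ->
        forall k x, d (gcomb a c c') k x = gcomb a (d c) (d c') k x,
      forall n c, (1 <= n)%N -> in_Cn alpha n c -> in_Cn alpha n.+1 (d c)
    & forall c, in_Cstar alpha c -> forall k x, d (d c) k x = 0].
Proof.
move=> d.
have char0 n : n.+1%:R != 0 :> R[i] by rewrite Num.Theory.pnatr_eq0.
have alpha_lin := hlc_alpha_scale_add hL.
have mC := m_c_cochain hL hmult.
have dC c : in_Cstar alpha c -> in_Cstar alpha (d c).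
  move=> [cC [N cN]]; split=> [[|k]|].
  - exact: (zero_cochain alpha_lin).
  - exact: (NR_cochain alpha_lin char0 mC (cC k)).
  - exists N.+1 => -[|k] // le_Nk x.
    exact (NR0r (p := 1) (g := c k) x mC (cN k le_Nk)).
have d0 c k x : (forall k', k = k'.+1 -> forall y, c k' y = 0) -> d c k x = 0.
  case: k x => // k x c0; exact (NR0r (p := 1) (g := c k) x mC (c0 k erefl)).
split=> //.
- move=> a c c' cC cC' [|k] x.
    by apply: esym; apply: etrans (addr0 _) _; exact: scaler0.
  exact (NR_combr (p := 1) (c k) (c' k) a x mC).
- move=> n c n0 [cC c0]; split; first exact: dC.
  move=> k kn x; apply: d0 => k' kE y; apply: c0.
  by rewrite -kE; apply: contra kn => /eqP ->.
(* Degree 0 of [d (d c)] is zero by definition, and degree 1 is the bracket of [m_c] with degree 0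
   of [d c], again zero by definition. *)
- move=> c cC [|[|k]] x; rewrite // /d.
    by apply: d0 => k' [<-].
  exact (NR_NR_odd alpha_lin char0 x mC (Cstar_cochain cC k) (circ_m_c_m_c hL hmult char0)).
Qed.
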